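(* Let $F:\mathbb{R}^p\times\mathbb{R}^m\to\mathbb{R}^p$ be locally Lipschitz and path differentiable, jointly in $(x,\theta)$, and let $J_F:\mathbb{R}^p\times\mathbb{R}^m\rightrightarrows\mathbb{R}^{p\times(p+m)}$ be a conservative Jacobian for $F$. Assume there exists $0\le\rho<1$ such that for every $(x,\theta)$ and every $[A,B]\in J_F(x,\theta)$, with $A\in\mathbb{R}^{p\times p}$ and $B\in\mathbb{R}^{p\times m}$, one has $\|A\|_{\mathrm{op}}\le\rho$. Let $x_0:\mathbb{R}^m\to\mathbb{R}^p$ be Lipschitz and path differentiable with conservative Jacobian $J_{x_0}$, let $\dot\theta\in\mathbb{R}^m$, and let $\bar x(\theta)$ be the unique fixed point of $F(\cdot,\theta)$. For $k\in\mathbb{N}$ and $\bar w_k\in\mathbb{R}^p$, let $\dot x_k\in\mathbb{R}^p$ be the output of the forward mode and $\bar\theta_k\in\mathbb{R}^m$ the output of the reverse mode of the algorithmic differentiation procedure described in the context. Then for almost all $\theta\in\mathbb{R}^m$, $$\dot x_k\to\frac{\partial\bar x}{\partial\theta}(\theta)\,\dot\theta\quad\text{as }k\to\infty.$$ Assume furthermore that, as $k\to\infty$, $\bar w_k\to\bar w$ (for example, $\bar w_k=\nabla\ell(x_k)$ for a $C^1$ loss $\ell$). Then for almost all $\theta\in\mathbb{R}^m$, $$\bar\theta_k^T\to\bar w^T\frac{\partial\bar x}{\partial\theta}(\theta)\quad\text{as }k\to\infty.$$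
   Context: Algorithmic differentiation procedure. Inputs: $k\in\mathbb{N}$, $\theta\in\mathbb{R}^m$, $\dot\theta\in\mathbb{R}^m$, $\bar w_k\in\mathbb{R}^p$, $x_0(\cdot)$, $F$, $J_F$, $J_{x_0}$. Put $x_0=x_0(\theta)$ and $x_i=F(x_{i-1},\theta)$ for $i=1,\dots,k$. Forward mode (JVP): $\dot x_0=J\dot\theta$ for some $J\in J_{x_0}(\theta)$; for $i=1,\dots,k$, $\dot x_i=A_{i-1}\dot x_{i-1}+B_{i-1}\dot\theta$ for some $[A_{i-1},B_{i-1}]\in J_F(x_{i-1},\theta)$. Return $\dot x_k$. Reverse mode (VJP): start with $\bar\theta_k=0$ and the given $\bar w_k$; for $i=k,k-1,\dots,1$, with some $[A_{i-1},B_{i-1}]\in J_F(x_{i-1},\theta)$, update $\bar\theta_k\leftarrow\bar\theta_k+B_{i-1}^T\bar w_i$ and set $\bar w_{i-1}=A_{i-1}^T\bar w_i$ (for $i\le k-1$ these $\bar w_i$ are internal variables of the run with $k$ steps, not the inputs of the other runs); finally $\bar\theta_k\leftarrow\bar\theta_k+J^T\bar w_0$ for some $J\in J_{x_0}(\theta)$. Return $\bar\theta_k$. The selections of elements of $J_F$ and $J_{x_0}$ are arbitrary. Conservative Jacobian: for a locally Lipschitz $f:\mathbb{R}^n\to\mathbb{R}^q$, a set-valued map $J:\mathbb{R}^n\rightrightarrows\mathbb{R}^{q\times n}$ is a conservative Jacobian for $f$ if it has closed graph, is locally bounded, is nowhere empty, and for every absolutely continuous $\gamma:[0,1]\to\mathbb{R}^n$,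 for almost every $t\in[0,1]$, $\frac{d}{dt}f(\gamma(t))=V\dot\gamma(t)$ for all $V\in J(\gamma(t))$. $f$ is path differentiable if it admits a conservative Jacobian. $[A,B]$ is the concatenation of $A$ and $B$; $\|\cdot\|_{\mathrm{op}}$ is the operator norm induced by the Euclidean norm. The contraction hypothesis implies that $F(\cdot,\theta)$ is a strict contraction, so it has a unique fixed point. *)

(* Defs.v *)
From HB Require Import structures.
From mathcomp Require Export all_boot all_order all_algebra.
From mathcomp Require Export all_classical all_reals all_analysis.

Set Implicit Arguments.
Unset Strict Implicit.
Unset Printing Implicit Defensive.

Import Order.TTheory GRing.Theory Num.Theory.
Import numFieldNormedType.Exports.

Local Open Scope classical_set_scope.
Local Open Scope ring_scope.

(* R^n is 'cV[R]_n; a pair (x, theta) of R^p x R^m is col_mx x theta, and a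
   matrix [A, B] of size p x (p + m) is row_mx A B.  The library norm `|_| on
   matrices is the max norm; apart from [op_norm] below, every notion here
   depends only on the equivalence class of the norm. *)

Section LebesgueNull.
Variables (R : realType) (m : nat).

Definition box (a b : 'cV[R]_m) : set 'cV[R]_m :=
  [set x | forall i, a i 0 <= x i 0 <= b i 0].

Definition box_volume (a b : 'cV[R]_m) : R := \prod_(i < m) (b i 0 - a i 0).

(* Lebesgue outer measure zero.  The boxes are indexed by a subset D of nat so
   that finite and empty coverings are allowed: this matters only for m = 0,
   where every box has volume 1. *)
Definition lebesgue_null (E : set 'cV[R]_m) : Prop :=
  forall eps : R, 0 < eps ->
  exists (D : set nat) (a b : nat -> 'cV[R]_m),
    [/\ forall k i, a k i 0 <= b k i 0,
        E `<=` \bigcup_(k in D) box (a k) (b k) &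
        (\esum_(k in D) (box_volume (a k) (b k))%:E <= eps%:E)%E].

Definition for_almost_all (P : 'cV[R]_m -> Prop) : Prop :=
  lebesgue_null [set x | ~ P x].

End LebesgueNull.

Section OperatorNorm.
Variable R : realType.

Definition norm2 n (x : 'cV[R]_n) : R := Num.sqrt (\sum_(i < n) x i 0 ^+ 2).

Definition op_norm q n (A : 'M[R]_(q, n)) : R :=
  sup [set norm2 (A *m x) | x in [set x : 'cV[R]_n | norm2 x <= 1]].

End OperatorNorm.

Section ConservativeJacobian.
Variables (R : realType) (n q : nat).

Definition locally_lipschitz (f : 'cV[R]_n -> 'cV[R]_q) : Prop :=
  forall x : 'cV[R]_n, lipschitz_on f (nbhs (x, x)).

(* gamma is total, but only its values on [0, 1] are constrained. *)
Definition absolutely_continuous01 (gamma : R -> 'cV[R]_n) : Prop :=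
  forall eps : R, 0 < eps -> exists2 delta : R, 0 < delta &
  forall (N : nat) (a b : 'I_N -> R),
    (forall j, 0 <= a j /\ a j <= b j /\ b j <= 1) ->
    trivIset [set: 'I_N] (fun j => `]a j, b j[%classic) ->
    \sum_(j < N) (b j - a j) < delta ->
    \sum_(j < N) `|gamma (b j) - gamma (a j)| < eps.

Record conservative_jacobian (f : 'cV[R]_n -> 'cV[R]_q)
    (J : 'cV[R]_n -> set 'M[R]_(q, n)) : Prop := {
  cj_lipschitz : locally_lipschitz f ;
  cj_closed_graph : closed [set z : 'cV[R]_n * 'M[R]_(q, n) | J z.1 z.2] ;
  cj_locally_bounded : forall x : 'cV[R]_n, exists M : R,
    \forall y \near x, forall V, J y V -> `|V| <= M ;
  cj_nonempty : forall x, J x !=set0 ;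
  cj_chain_rule : forall gamma : R -> 'cV[R]_n,
    absolutely_continuous01 gamma ->
    {ae @lebesgue_measure R, forall t : R, t \in `[0, 1] ->
      [/\ derivable gamma t 1, derivable (f \o gamma) t 1 &
          forall V, J (gamma t) V ->
            'D_1 (f \o gamma) t = V *m 'D_1 gamma t]} }.

Definition path_differentiable (f : 'cV[R]_n -> 'cV[R]_q) : Prop :=
  exists J : 'cV[R]_n -> set 'M[R]_(q, n), conservative_jacobian f J.

(* [jacobian] of the library is for row vectors, where it acts on the right:
   this is its column-vector counterpart.  It is meaningful only together
   with [differentiable f x]. *)
Definition jac (f : 'cV[R]_n -> 'cV[R]_q) (x : 'cV[R]_n) : 'M[R]_(q, n) :=
  \matrix_(i, j) ('d f x (delta_mx j 0)) i 0.

End ConservativeJacobian.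

Section AlgorithmicDifferentiation.
Variables (R : realType) (p m : nat).
Variables (F : 'cV[R]_(p + m) -> 'cV[R]_p).
Variables (JF : 'cV[R]_(p + m) -> set 'M[R]_(p, p + m)).
Variables (x0 : 'cV[R]_m -> 'cV[R]_p) (Jx0 : 'cV[R]_m -> set 'M[R]_(p, m)).
Variable theta : 'cV[R]_m.

Fixpoint iterate (k : nat) : 'cV[R]_p :=
  if k is i.+1 then F (col_mx (iterate i) theta) else x0 theta.

(* The selections being arbitrary, both modes are relations between the
   inputs and the possible outputs. *)

Fixpoint forward_mode (k : nat) (dtheta : 'cV[R]_m) (out : 'cV[R]_p) : Prop :=
  if k is i.+1 then
    exists (dx : 'cV[R]_p) (A : 'M[R]_p) (B : 'M[R]_(p, m)),
      [/\ forward_mode i dtheta dx,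
          JF (col_mx (iterate i) theta) (row_mx A B) &
          out = A *m dx + B *m dtheta]
  else exists2 J, Jx0 theta J & out = J *m dtheta.

(* The state (tbar, w) holds the accumulator and the current \bar w_i;
   i steps remain. *)
Fixpoint reverse_loop (i : nat) (tbar : 'cV[R]_m) (w : 'cV[R]_p)
    (out : 'cV[R]_m) : Prop :=
  if i is j.+1 then
    exists (A : 'M[R]_p) (B : 'M[R]_(p, m)),
      JF (col_mx (iterate j) theta) (row_mx A B) /\
      reverse_loop j (tbar + B^T *m w) (A^T *m w) out
  else exists2 J, Jx0 theta J & out = tbar + J^T *m w.

Definition reverse_mode (k : nat) (w : 'cV[R]_p) (out : 'cV[R]_m) : Prop :=
  reverse_loop k 0 w out.

End AlgorithmicDifferentiation.

(* Main.v *)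
(** Write [z theta] for the pair (xbar theta, theta).  The mean value inequality
    for Lipschitz paths makes F(., theta) a rho-contraction, so xbar is locally
    Lipschitz.  The chain rule along t |-> z (y + t v) then shows that at almost
    every point of a line with direction v, the derivative of xbar along v
    solves d = A d + B v for every [A, B] in J_F(z theta); this equation has only
    one solution for each [A, B], so its solution does not depend on the choice
    of [A, B] there.  The set of theta where the solution for v = e_j depends on
    [A, B] is a countable union of sets whose closures meet the lines parallel
    to e_j in negligible sets; being closed, these are null, by an elementary
    case of Fubini's theorem.

    At the remaining theta, a single matrix D satisfies D = A D + B for all
    [A, B] in J_F(z theta).  By upper semicontinuity of J_F, A D + B is close
    to D for all [A, B] in J_F(u) with u near z theta.  Integrating along
    segments, xbar is differentiable at theta with Jacobian D (so Rademacher's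
    theorem is not needed), and the recursion P -> A P + B computed by both
    differentiation modes contracts towards D, uniformly in the selections. *)
Require Import Defs.
From mathcomp Require Import all_boot all_order all_algebra.
From mathcomp Require Import all_classical all_reals all_analysis.
From mathcomp Require Import ring lra.
Import Order.TTheory GRing.Theory Num.Theory.
Import numFieldNormedType.Exports.
Local Open Scope classical_set_scope.
Local Open Scope ring_scope.

(** * Norms of matrices *)

Section MatrixNorms.
Set Implicit Arguments.
Unset Strict Implicit.
Variable R : realType.

Lemma mx_entry_le q n (A : 'M[R]_(q, n)) i j : `|A i j| <= `|A|.
Proof.
rewrite [leRHS]/Num.norm /= mx_normrE.
by apply/bigmax_geP; right => /=; exists (i, j).
Qed.

Lemma mx_norm_leP q n (A : 'M[R]_(q, n)) c : 0 <= c ->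
  (forall i j, `|A i j| <= c) -> `|A| <= c.
Proof.
move=> c0 h; rewrite [leLHS]/Num.norm /= mx_normrE.
by apply/bigmax_leP; split => // -[i j] _; exact: h.
Qed.

Lemma mulmx_norm_le q n r (A : 'M[R]_(q, n)) (B : 'M[R]_(n, r)) :
  `|A *m B| <= n%:R * (`|A| * `|B|).
Proof.
apply: mx_norm_leP => [|i j]; first by rewrite !mulr_ge0.
rewrite mxE (le_trans (ler_norm_sum _ _ _)) //.
rewrite (@le_trans _ _ (\sum_(k < n) (`|A| * `|B|))) //; last first.
  by rewrite sumr_const card_ord mulr_natl.
by apply: ler_sum => k _; rewrite normrM ler_pM // mx_entry_le.
Qed.

Lemma trmx_norm q n (A : 'M[R]_(q, n)) : `|A^T| = `|A|.
Proof.
apply/eqP; rewrite eq_le; apply/andP; split; apply: mx_norm_leP => // i j.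
  by rewrite mxE mx_entry_le.
by have := mx_entry_le A^T j i; rewrite mxE.
Qed.

Lemma row_mx_norm_l q n r (A : 'M[R]_(q, n)) (B : 'M[R]_(q, r)) :
  `|A| <= `|row_mx A B|.
Proof.
apply: mx_norm_leP => // i j.
by have := mx_entry_le (row_mx A B) i (lshift r j); rewrite row_mxEl.
Qed.

Lemma row_mx_norm_r q n r (A : 'M[R]_(q, n)) (B : 'M[R]_(q, r)) :
  `|B| <= `|row_mx A B|.
Proof.
apply: mx_norm_leP => // i j.
by have := mx_entry_le (row_mx A B) i (rshift n j); rewrite row_mxEr.
Qed.

Lemma col_mx_norm_le n r q (A : 'M[R]_(n, q)) (B : 'M[R]_(r, q)) c :
  `|A| <= c -> `|B| <= c -> `|col_mx A B| <= c.
Proof.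
move=> Ac Bc; apply: mx_norm_leP => [|i j]; first exact: le_trans (normr_ge0 _) Ac.
by case: (split_ordP i) => k ->; rewrite ?col_mxEu ?col_mxEd;
  [apply: le_trans Ac|apply: le_trans Bc];
  exact: mx_entry_le.
Qed.

Definition dot n (x y : 'cV[R]_n) : R := \sum_(i < n) x i 0 * y i 0.

Lemma norm2_ge0 n (x : 'cV[R]_n) : 0 <= norm2 x.
Proof. exact: sqrtr_ge0. Qed.

Lemma norm2_sqr n (x : 'cV[R]_n) : norm2 x ^+ 2 = dot x x.
Proof. by rewrite sqr_sqrtr //; apply: sumr_ge0 => i _; rewrite sqr_ge0. Qed.

Lemma norm2_ge_norm n (x : 'cV[R]_n) : `|x| <= norm2 x.
Proof.
apply: mx_norm_leP => [|i j]; first exact: norm2_ge0.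
rewrite ord1 -sqrtr_sqr ler_sqrt; last first.
  by apply: sumr_ge0 => k _; rewrite sqr_ge0.
rewrite (bigD1 i) //= lerDl; apply: sumr_ge0 => k _; exact: sqr_ge0.
Qed.

Lemma norm2_le_norm n (x : 'cV[R]_n) : norm2 x <= Num.sqrt n%:R * `|x|.
Proof.
rewrite -[X in _ * X]ger0_norm // -(sqrtr_sqr `|x|) -sqrtrM //.
rewrite ler_sqrt ?mulr_ge0 ?sqr_ge0 //.
rewrite (@le_trans _ _ (\sum_(i < n) `|x| ^+ 2)) //; last first.
  by rewrite sumr_const card_ord mulr_natl.
apply: ler_sum => i _; rewrite -(real_normK (num_real (x i 0))).
by rewrite lerXn2r ?nnegrE // mx_entry_le.
Qed.

Lemma norm2_eq0 n (x : 'cV[R]_n) : norm2 x = 0 -> x = 0.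
Proof.
move=> h; have := norm2_ge_norm x; rewrite h => h2.
by apply/eqP; rewrite -normr_le0.
Qed.

Lemma norm20 n : norm2 (0 : 'cV[R]_n) = 0.
Proof.
rewrite /norm2 big1 ?sqrtr0 // => i _; by rewrite mxE expr0n.
Qed.

Lemma dotC n (x y : 'cV[R]_n) : dot x y = dot y x.
Proof. by apply: eq_bigr => i _; rewrite mulrC. Qed.

Lemma dotDr n (x y z : 'cV[R]_n) : dot x (y + z) = dot x y + dot x z.
Proof. by rewrite -big_split; apply: eq_bigr => i _; rewrite mxE mulrDr. Qed.

Lemma dotZr n (x y : 'cV[R]_n) c : dot x (c *: y) = c * dot x y.
Proof. by rewrite mulr_sumr; apply: eq_bigr => i _; rewrite mxE mulrCA. Qed.

Lemma dotBr n (x y z : 'cV[R]_n) : dot x (y - z) = dot x y - dot x z.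
Proof. by rewrite dotDr -scaleN1r dotZr mulN1r. Qed.

Lemma norm2Z n c (x : 'cV[R]_n) : norm2 (c *: x) = `|c| * norm2 x.
Proof.
rewrite /norm2 -sqrtr_sqr -sqrtrM ?sqr_ge0 // mulr_sumr.
by congr Num.sqrt; apply: eq_bigr => i _; rewrite mxE exprMn.
Qed.

(** Cauchy-Schwarz: away from zero vectors, expand the square of [norm2 y *: x - norm2 x *: y] and
    divide by [norm2 x * norm2 y]. *)
Lemma dot_le n (x y : 'cV[R]_n) : dot x y <= norm2 x * norm2 y.
Proof.
have [/eqP/norm2_eq0 ->|x0] := boolP (norm2 x == 0).
  by rewrite norm20 mul0r /dot big1 // => i _; rewrite mxE mul0r.
have [/eqP/norm2_eq0 ->|y0] := boolP (norm2 y == 0).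
  by rewrite norm20 mulr0 /dot big1 // => i _; rewrite mxE mulr0.
have xy0 : 0 < norm2 x * norm2 y.
  by rewrite mulr_gt0 // lt_def ?x0 ?y0 norm2_ge0.
set a := norm2 x; set b := norm2 y.
have : 0 <= dot (b *: x - a *: y) (b *: x - a *: y).
  by rewrite -norm2_sqr sqr_ge0.
rewrite dotBr !dotZr ![dot (_ - _) _]dotC !dotBr !dotZr -!norm2_sqr -/a -/b (dotC y x) => h.
rewrite -subr_ge0 -(pmulr_rge0 _ xy0) -/a -/b; nra.
Qed.

Lemma norm2D n (x y : 'cV[R]_n) : norm2 (x + y) <= norm2 x + norm2 y.
Proof.
rewrite -(@ler_pXn2r _ 2) ?nnegrE ?addr_ge0 ?norm2_ge0 //.
rewrite norm2_sqr dotDr ![dot (_ + _) _]dotC !dotDr -!norm2_sqr (dotC y x).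
have := dot_le x y; nra.
Qed.

Lemma op_norm_le q n (A : 'M[R]_(q, n)) (x : 'cV[R]_n) c :
  op_norm A <= c -> norm2 (A *m x) <= c * norm2 x.
Proof.
move=> Ac; have [/eqP/norm2_eq0 ->|x0] := boolP (norm2 x == 0).
  by rewrite mulmx0 !norm20 mulr0.
have {}x0 : 0 < norm2 x by rewrite lt_def x0 norm2_ge0.
rewrite -ler_pdivrMr // (le_trans _ Ac) //.
have -> : norm2 (A *m x) / norm2 x = norm2 (A *m ((norm2 x)^-1 *: x)).
  by rewrite -scalemxAr norm2Z ger0_norm ?invr_ge0 ?norm2_ge0 // mulrC.
apply: sup_upper_bound; last first.
  exists ((norm2 x)^-1 *: x) => //=.
  by rewrite norm2Z ger0_norm ?invr_ge0 ?norm2_ge0 // mulVf // gt_eqF.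
(* A supremum bounds only a nonempty bounded set; boundedness follows by comparison with the max
   norm. *)
split; first by exists (norm2 (A *m 0)), 0 => //=; rewrite norm20.
exists (Num.sqrt q%:R * (n%:R * (`|A| * 1))) => _ [y /= y1 <-].
rewrite (le_trans (norm2_le_norm _)) // ler_wpM2l ?sqrtr_ge0 //.
rewrite (le_trans (mulmx_norm_le _ _)) // ler_wpM2l // ler_wpM2l //.
exact: le_trans (norm2_ge_norm _) y1.
Qed.

(** Heine-Borel for row vectors is transported through [vec_mx], which is continuous because it does
    not increase the max norm. *)
Lemma mx_ball_compact q n (c : R) : compact [set A : 'M[R]_(q, n) | `|A| <= c].
Proof.
have h : compact [set v : 'rV[R]_(q * n) | `|v| <= c].
  apply: bounded_closed_compact.
    by exists c; split; [exact: num_real|move=> M cM v /= vc; rewrite (le_trans vc) // ltW].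
  rewrite (_ : mkset _ = closed_ball_ Num.norm 0 c); first exact: closed_closed_ball_.
  by apply/seteqP; split => v /=; rewrite /closed_ball_ /= sub0r normrN.
have -> : [set A : 'M[R]_(q, n) | `|A| <= c] = vec_mx @` [set v | `|v| <= c].
  apply/seteqP; split => [A /= Ac|_ [v /= vc <-]].
    exists (mxvec A); last exact: mxvecK.
    apply: mx_norm_leP => [|i k]; first exact: le_trans (normr_ge0 _) Ac.
    rewrite ord1; case/mxvec_indexP: k => i' j'.
    by rewrite mxvecE (le_trans _ Ac) // mx_entry_le.
  apply: mx_norm_leP => [|i j]; first exact: le_trans (normr_ge0 _) vc.
  by rewrite mxE (le_trans _ vc) // mx_entry_le.
apply: continuous_compact h; apply: continuous_subspaceT => v.
move=> B /= /nbhs_normP [e e0 eB]; apply: (proj2 (nbhs_normP v _)).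
exists e => // w /= vw.
apply: eB => /=; apply: le_lt_trans vw; apply: mx_norm_leP => // i j.
by have := mx_entry_le (v - w) 0 (mxvec_index i j); rewrite !mxE.
Qed.

End MatrixNorms.

(** * Mean value inequality *)

Section MeanValue.
Set Implicit Arguments.
Unset Strict Implicit.
Variable R : realType.
Local Notation mu := (@lebesgue_measure R).

Lemma negligible_open_cover (Z : set R) (eps : R) : 0 < eps ->
  mu.-negligible Z ->
  exists U : set R, [/\ open U, Z `<=` U & (mu U < eps%:E)%E].
Proof.
move=> e0 [N [mN N0 ZN]].
have [|U [oU NU Ueps]] := lebesgue_regularity_outer mN _ e0.
  by rewrite [X in (X < _)%E]N0 ltry.
exists U; split => //; first exact: subset_trans NU.
rewrite (le_lt_trans _ Ueps) // -[leRHS]adde0 -N0 -measureU //.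
- by rewrite setUC setDUK.
- by apply: measurableD => //; exact: measurable_realfun.open_measurable.
- by rewrite setDE -setIA setICl setI0.
Qed.

(** Continuous induction on [0, 1]: the supremum of the initial segments on which [P] holds is
    attained by the left-limit hypothesis, and the right-step hypothesis would move past it if it
    were less than 1. *)
Lemma real_induction (P : R -> Prop) : P 0 ->
  (forall t, 0 <= t < 1 -> (forall s, 0 <= s <= t -> P s) ->
    exists2 d, 0 < d & forall s, t < s < t + d -> P s) ->
  (forall t, 0 < t <= 1 -> (forall s, 0 <= s < t -> P s) -> P t) ->
  P 1.
Proof.
move=> P0 Pright Pleft.
pose A := [set t : R | 0 <= t <= 1 /\ forall s, 0 <= s <= t -> P s].
have A0 : A 0.
  split=> [|s /andP[s0 s1]]; first by rewrite lexx ler01.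
  by have -> : s = 0 by apply/eqP; rewrite eq_le s0 s1.
have ubA : ubound A 1 by move=> t [/andP[]].
have supA : has_sup A by split; [exists 0|exists 1].
set T := sup A.
have T0 : 0 <= T by exact: sup_upper_bound.
have T1 : T <= 1 by apply: sup_le_ub => //; exists 0.
have PltT s : 0 <= s < T -> P s.
  move=> /andP[s0 sT]; have [|a [_ Pa] sa] := @sup_adherent _ A (T - s) _ supA.
    by rewrite subr_gt0.
  by apply: Pa; rewrite s0; move: sa; rewrite -/T subKr => /ltW.
have PT s : 0 <= s <= T -> P s.
  move=> /andP[s0]; rewrite le_eqVlt => /orP[/eqP ->|sT]; last by apply: PltT; rewrite s0.
  have [->//|T0'] := eqVneq T 0.
  by apply: Pleft => //; rewrite T1 lt_def T0' T0.
have [T1'|T1'] := ltP T 1; last by apply: PT; rewrite ler01.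
have [|d d0 Pd] := Pright T _ PT; first by rewrite T0.
(* Halving [d] keeps [u] strictly inside the window where [P] is known; the other bound keeps it in
   [0, 1]. *)
pose u := T + Num.min (d / 2) (1 - T).
have Tu : T < u by rewrite ltrDl lt_min divr_gt0 //= subr_gt0.
have : A u.
  split=> [|s /andP[s0 su]].
    by rewrite (le_trans T0 (ltW Tu)) /= /u -lerBrDl ge_min lexx orbT.
  have [sT|Ts] := leP s T; first by apply: PT; rewrite s0.
  apply: Pd; rewrite Ts /= (le_lt_trans su) // /u ltrD2l gt_min.
  by rewrite ltr_pdivrMr // ltr_pMr // ltr1n.
by move=> /(sup_upper_bound supA); rewrite leNgt -/T Tu.
Qed.

(** Cover the exceptional set by an open [U] of small measure and let [G t] be the measure of [U] in
    [0, t]. Then [f t - (c + eta / 2) * t - L * G t] never exceeds its value at 0: inside [U], [G]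
    grows with slope 1 and absorbs the Lipschitz growth of [f]; outside [U], the bound on the right
    derivative applies. The correction costs at most [L] times the measure of [U]. *)
Lemma ae_right_deriv_le (f : R -> R) (c L delta : R) :
  0 <= c -> 0 <= L -> 0 < delta ->
  (forall s t, 0 <= s -> s < t -> t <= 1 -> t - s < delta ->
    f t - f s <= L * (t - s)) ->
  {ae mu, forall t : R, t \in `[0, 1] -> forall e, 0 < e ->
    exists2 d, 0 < d &
    forall s, t < s < t + d -> f s - f t <= (c + e) * (s - t)} ->
  f 1 - f 0 <= c.
Proof.
move=> c0 L0 delta0 fL fae; apply/ler_addgt0Pr => eta eta0.
have eps0 : 0 < eta / 2 / (L + 1) by rewrite !divr_gt0 // ltr_wpDl.
have [U [oU ZU Ueps]] := negligible_open_cover eps0 fae.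
have mU : measurable U by exact: measurable_realfun.open_measurable.
have mI (t : R) : measurable (`[0, t]%classic : set R) by [].
have Ufin t : (mu (U `&` `[0%R, t]%classic) < (eta / 2 / (L + 1))%:E)%E.
  rewrite (le_lt_trans _ Ueps) // le_measure ?inE //; exact: measurableI.
pose G t := fine (mu (U `&` `[0%R, t]%classic)).
have GE t : mu (U `&` `[0%R, t]%classic) = (G t)%:E.
  by rewrite fineK // ge0_fin_numE // (lt_trans (Ufin t)) // ltry.
have G0 t : 0 <= G t by rewrite -lee_fin -GE.
have Geps t : G t <= eta / 2 / (L + 1) by rewrite ltW // -lte_fin -GE.
have Gmono s t : s <= t -> G s <= G t.
  move=> st; rewrite -lee_fin -!GE le_measure ?inE //; try exact: measurableI.
  apply: setIS; apply: subset_itvl; rewrite bnd_simp; exact: st.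
have GU s t : 0 <= s -> s < t -> (forall r, s < r <= t -> U r) -> t - s <= G t - G s.
  move=> s0 st Ust; rewrite -lerBlDr opprK -lee_fin EFinD -!GE.
  have -> : (t - s)%:E = mu `]s, t]%classic.
    by rewrite lebesgue_measure_itv /= lte_fin st EFinB.
  rewrite -measureU //; [|exact: measurableI|].
  - rewrite le_measure ?inE //; [|exact: measurableI|].
      by apply: measurableU => //; exact: measurableI.
    move=> r [/=|[Ur /=]]; rewrite !in_itv /=.
      by move=> /andP[sr rt]; split; [apply: Ust; rewrite sr|rewrite rt (le_trans s0 (ltW sr))].
    by move=> /andP[r0 rs]; split => //; rewrite r0 (le_trans rs (ltW st)).
  - apply/seteqP; split => // r [/=]; rewrite in_itv /= => /andP[sr _] [_ /=].
    by rewrite in_itv /= => /andP[_]; rewrite leNgt sr.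
pose h t := f t - (c + eta / 2) * t - L * G t.
have ce0 : 0 <= c + eta / 2 by rewrite addr_ge0 // ltW // divr_gt0.
have : h 1 <= h 0.
  apply: (@real_induction (fun s => s <= 1 -> h s <= h 0)) => //.
  - move=> t /andP[t0 t1] IH.
    have ht : h t <= h 0 by apply: IH; rewrite ?t0 ?lexx // ltW.
    have [tU|tU] := pselect (U t).
      have /nbhs_ballP[d /= d0 dU] : nbhs t U by exact: open_nbhs_nbhs.
      exists (Num.min d delta); first by rewrite lt_min d0.
      move=> s /andP[ts std] s1; rewrite (le_trans _ ht) // /h.
      move: std; rewrite -ltrBlDl lt_min => /andP[sd sdelta].
      have h1 := fL t s t0 ts s1 sdelta.
      have h2 : s - t <= G s - G t.
        apply: GU => // r /andP[tr rs]; apply: dU.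
        rewrite /ball /= distrC gtr0_norm ?subr_gt0 //.
        by rewrite (le_lt_trans _ sd) // lerB.
      have h3 : (c + eta / 2) * t <= (c + eta / 2) * s by rewrite ler_wpM2l // ltW.
      have h4 : L * (s - t) <= L * (G s - G t) by rewrite ler_wpM2l.
      rewrite mulrBr in h4; rewrite mulrBr in h1; lra.
    have : t \in `[0, 1] -> forall e : R, 0 < e ->
        exists2 d, 0 < d & forall s, t < s < t + d -> f s - f t <= (c + e) * (s - t).
      by apply: contrapT => nP; exact/tU/ZU.
    move=> /(_ _ (eta / 2)) [||d d0 dP]; [by rewrite in_itv /= t0 ltW|by rewrite divr_gt0|].
    exists d => // s sd s1; rewrite (le_trans _ ht) // /h.
    have := dP s sd; move: sd => /andP[ts _].
    have := Gmono t s (ltW ts) => /(ler_wpM2l L0); rewrite mulrBr; lra.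
  - move=> t /andP[t0 t1] IH _; apply/ler_addgt0Pr => e e0.
    (* To pass to the left limit, step back by a [d] over which [f] rises by at most [L * d <= e];
       the other two bounds keep [t - d] in [0, 1] and within reach of the Lipschitz bound. *)
    have dpos : 0 < Num.min (Num.min t (delta / 2)) (e / (L + 1)).
      by rewrite !lt_min t0 !divr_gt0 // ltr_wpDl.
    set d := Num.min _ _ in dpos.
    have := IH (t - d); have dt : d <= t by rewrite /d !ge_min lexx.
    have dd : d < delta.
      have : d <= delta / 2 by rewrite /d !ge_min lexx orbT.
      lra.
    have de : L * d <= e.
      have : d <= e / (L + 1) by rewrite /d !ge_min lexx orbT.
      rewrite ler_pdivlMr ?ltr_wpDl //; nra.
    have td : t - d < t by lra.
    rewrite subr_ge0 dt td => /(_ isT) H.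
    have {}H := H (ltW (lt_le_trans td t1)).
    rewrite -[leRHS]addrC -lerBlDl (le_trans _ H) // /h.
    have := fL (t - d) t _ td t1; rewrite subr_ge0 dt subKr => /(_ isT dd) h1.
    have := Gmono _ _ (ltW td) => /(ler_wpM2l L0) h2.
    have := ler_wpM2l ce0 (ltW td); lra.
rewrite /h.
have : L * G 1 <= eta / 2.
  rewrite (@le_trans _ _ (L * (eta / 2 / (L + 1)))) //.
    by rewrite ler_wpM2l.
  rewrite mulrA ler_pdivrMr ?ltr_wpDl //; nra.
have : 0 <= L * G 0 by rewrite mulr_ge0.
rewrite !mulr1 !mulr0; lra.
Qed.

End MeanValue.

(** * Lipschitz paths and the vector-valued mean value inequality *)

Section LipschitzPaths.
Set Implicit Arguments.
Unset Strict Implicit.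
Variable R : realType.
Local Notation mu := (@lebesgue_measure R).

Lemma locally_lipschitzE n q (f : 'cV[R]_n -> 'cV[R]_q) : locally_lipschitz f ->
  forall x, exists r L : R, [/\ 0 < r, 0 < L &
    forall y z, `|x - y| < r -> `|x - z| < r -> `|f y - f z| <= L * `|y - z|].
Proof.
move=> fL x; have /pinfty_ex_gt0 [L L0] := fL x.
move=> [[A B]] [/nbhs_normP [ra ra0 rA] /nbhs_normP [rb rb0 rB]] /= AB.
exists (Num.min ra rb), L; split => // [|y z]; first by rewrite lt_min ra0.
rewrite !lt_min => /andP[ya _] /andP[_ zb].
by apply: (AB (y, z)); split => /=; [exact: rA|exact: rB].
Qed.

Lemma locally_lipschitzI n q (f : 'cV[R]_n -> 'cV[R]_q) :
  (forall x, exists r L : R, [/\ 0 < r, 0 < L &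
    forall y z, `|x - y| < r -> `|x - z| < r -> `|f y - f z| <= L * `|y - z|]) ->
  locally_lipschitz f.
Proof.
move=> fL x; have [r [L [r0 L0 h]]] := fL x.
apply: (@klipschitzW _ _ _ L).
exists ([set y | `|x - y| < r], [set y | `|x - y| < r]) => /=.
  by split; apply: (proj2 (nbhs_normP x _)); exists r.
by move=> [y z] [/= yr zr]; exact: h.
Qed.

(** The constants are uniform over [0, 1], but only close points are compared: this is what
    compactness yields directly, and absolute continuity needs no more. *)
Definition locally_lipschitz01 n (g : R -> 'cV[R]_n) : Prop :=
  exists d L : R, [/\ 0 < d, 0 <= L & forall s t, 0 <= s <= 1 -> 0 <= t <= 1 ->
    `|s - t| < d -> `|g s - g t| <= L * `|s - t|].

Lemma locally_lipschitz_line n q (f : 'cV[R]_n -> 'cV[R]_q) a v :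
  locally_lipschitz f -> locally_lipschitz01 (fun t => f (a + t *: v)).
Proof.
move=> fL; pose g t := f (a + t *: v).
(* One parameter serves as radius and as inverse Lipschitz constant, so letting it tend to 0 relaxes
   both requirements. *)
pose P d t := forall s s', `|t - s| < d -> `|t - s'| < d ->
  `|g s - g s'| <= d^-1 * `|s - s'|.
have /compact_near_coveringP cpt := @segment_compact R 0 1.
have : \forall d \near (0 : R)^'+, `[0, 1]%classic `<=` P d.
  apply: cpt => t _.
  have [r [L [r0 L0 h]]] := locally_lipschitzE fL (a + t *: v).
  (* Half of the radius is spent on moving the centre from [t] to [u], half on moving from [u] to
     [s]; adding 1 allows [v = 0]. *)
  pose e := r / (`|v| + 1) / 2.
  have v1 : 0 < `|v| + 1 by rewrite ltr_wpDl.
  have e0 : 0 < e by rewrite !divr_gt0.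
  exists (ball_ Num.norm t e, [set d | 0 < d /\ d < e /\ d < (L * (`|v| + 1))^-1]).
    split; first by apply/nbhs_normP; exists e.
    near=> d; split => //; split; near: d; apply: nbhs_right_lt => //.
    by rewrite invr_gt0 mulr_gt0.
  move=> [u d] [/= ut [d0 [de dL]]] s s' us us'; rewrite /g.
  have key z : `|u - z| < d -> `|a + t *: v - (a + z *: v)| < r.
    move=> uz; rewrite opprD addrACA subrr add0r -scalerBl normrZ.
    have tz : `|t - z| < r / (`|v| + 1).
      rewrite (le_lt_trans (ler_distD u _ _)) // [ltRHS]splitr ltrD //.
      exact: lt_trans de.
    apply: (@le_lt_trans _ _ (`|t - z| * (`|v| + 1))); first by rewrite ler_wpM2l // lerDl.
    by rewrite -ltr_pdivlMr.
  rewrite (le_trans (h _ _ (key _ us) (key _ us'))) //.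
  rewrite opprD addrACA subrr add0r -scalerBl normrZ mulrCA mulrC ler_wpM2r //.
  rewrite (@le_trans _ _ (L * (`|v| + 1))) //; first by rewrite ler_pM2l // lerDl.
  by rewrite -[leLHS]invrK lef_pV2 ?posrE ?invr_gt0 ?mulr_gt0 // ltW.
move=> near_d; near (0 : R)^'+ => d.
have d0 : 0 < d by [].
exists d, d^-1; split => //; first by rewrite invr_ge0 ltW.
move=> s t s01 t01 st.
have Pd : `[0, 1]%classic `<=` P d by near: d.
by apply: (Pd s) => //=; rewrite subrr normr0.
Unshelve. all: by end_near. Qed.

Lemma absolutely_continuous_lipschitz01 n (g : R -> 'cV[R]_n) :
  locally_lipschitz01 g -> absolutely_continuous01 g.
Proof.
move=> [d [L [d0 L0 gL]]] eps eps0.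
have L1 : 0 < L + 1 by rewrite ltr_wpDl.
exists (Num.min d (eps / (L + 1))); first by rewrite lt_min d0 divr_gt0.
move=> N a b ab _; rewrite lt_min => /andP[sd seps].
apply: (@le_lt_trans _ _ (\sum_(j < N) (L + 1) * (b j - a j))); last first.
  by rewrite -mulr_sumr mulrC -ltr_pdivlMr.
apply: ler_sum => j _; have [aj0 [abj bj1]] := ab j.
have abj0 : 0 <= b j - a j by rewrite subr_ge0.
rewrite -[X in _ * X]ger0_norm // (@le_trans _ _ (L * `|b j - a j|)) //; last first.
  by rewrite ler_wpM2r // lerDl.
apply: gL; first by rewrite bj1 (le_trans aj0).
  by rewrite aj0 (le_trans abj).
(* Each interval is shorter than [d] because the total length is. *)
rewrite ger0_norm //; apply: le_lt_trans sd.
by rewrite (bigD1 j) //= lerDl sumr_ge0 // => k _; rewrite subr_ge0; have [_ []] := ab k.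
Qed.

(** Projecting on the increment [w] itself reduces to the scalar inequality: [dot w (g t)] increases
    by exactly [norm2 w ^+ 2], while by Cauchy-Schwarz its derivative is at most [norm2 w * c]
    almost everywhere. *)
Lemma norm2_increment_le n (g : R -> 'cV[R]_n) c : 0 <= c ->
  locally_lipschitz01 g ->
  {ae mu, forall t : R, t \in `[0, 1] ->
    derivable g t 1 /\ norm2 ('D_1 g t) <= c} ->
  norm2 (g 1 - g 0) <= c.
Proof.
move=> c0 [d [L [d0 L0 gL]]] gae; set w := g 1 - g 0.
have [/eqP w0|w0] := boolP (norm2 w == 0); first by rewrite w0.
have {}w0 : 0 < norm2 w by rewrite lt_def w0 norm2_ge0.
suff : dot w (g 1) - dot w (g 0) <= norm2 w * c.
  by rewrite -dotBr -norm2_sqr expr2 ler_pM2l.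
pose L' := norm2 w * (Num.sqrt n%:R * L).
apply: (@ae_right_deriv_le R (fun t => dot w (g t)) _ L' d) => //.
- by rewrite mulr_ge0 // norm2_ge0.
- by rewrite !mulr_ge0 ?norm2_ge0 ?sqrtr_ge0.
- move=> s t s0 st t1 std; rewrite -dotBr (le_trans (dot_le _ _)) //.
  rewrite -!mulrA ler_wpM2l ?norm2_ge0 // (le_trans (norm2_le_norm _)) //.
  rewrite ler_wpM2l ?sqrtr_ge0 // -[X in _ * X]gtr0_norm ?subr_gt0 // gL ?s0 ?t1 //=.
  + by rewrite (le_trans s0) // ltW.
  + by rewrite (le_trans _ t1) // ltW.
  + by rewrite gtr0_norm // subr_gt0.
move: gae; apply: (@filterS _ _ (ae_filter_ringOfSetsType mu)) => t h /h [dgt gc] e e0.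
(* An error [e'] on the difference quotient in the max norm costs at most
   [norm2 w * Num.sqrt n%:R * e'] after projection. *)
pose e' := e / (norm2 w * Num.sqrt n%:R + 1).
have den0 : 0 < norm2 w * Num.sqrt n%:R + 1.
  by rewrite ltr_wpDl // mulr_ge0 ?norm2_ge0 ?sqrtr_ge0.
have e'0 : 0 < e' by rewrite divr_gt0.
have /cvgrPdist_lt /(_ _ e'0) := dgt.
move=> /nbhs_normP [r /= r0 hr]; exists r => // s /andP[ts str].
have st0 : 0 < s - t by rewrite subr_gt0.
have /= := hr (s - t); rewrite sub0r normrN gtr0_norm // ltrBlDl => /(_ str).
rewrite gt_eqF // => /(_ isT).
rewrite -[lim _]/('D_1 g t) /= => hq.
have -> : dot w (g s) - dot w (g t) =
    (s - t) * dot w ((s - t)^-1 *: (g ((s - t) *: 1 + t) - g t)).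
  by rewrite dotZr mulrA divff ?mul1r ?dotBr ?gt_eqF // /GRing.scale /= mulr1 subrK.
rewrite mulrC ler_pM2r //.
set q := _ *: _ in hq *.
rewrite -(subrKC ('D_1 g t) q) dotDr lerD //.
  by rewrite (le_trans (dot_le _ _)) // ler_wpM2l // norm2_ge0.
rewrite (le_trans (dot_le _ _)) // (@le_trans _ _ (norm2 w * (Num.sqrt n%:R * e'))) //.
  rewrite ler_wpM2l ?norm2_ge0 // (le_trans (norm2_le_norm _)) // ler_wpM2l ?sqrtr_ge0 //.
  by rewrite distrC ltW.
rewrite mulrA /e' mulrCA ger_pMr // ler_pdivrMr // mul1r; lra.
Qed.

End LipschitzPaths.

(** * Null sets *)

Section NullSets.
Set Implicit Arguments.
Unset Strict Implicit.
Variable R : realType.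
Local Notation mu := (@lebesgue_measure R).

Lemma lebesgue_null_sub m (E E' : set 'cV[R]_m) :
  E `<=` E' -> lebesgue_null E' -> lebesgue_null E.
Proof.
move=> EE' nE' eps /nE' [D [a [b [ab cov vol]]]].
by exists D, a, b; split => //; exact: subset_trans cov.
Qed.

Lemma box_volume_ge0 m (a b : 'cV[R]_m) :
  (forall i, a i 0 <= b i 0) -> 0 <= box_volume a b.
Proof. by move=> ab; apply: prodr_ge0 => i _; rewrite subr_ge0. Qed.

(** Coverings indexed by pairs or by grid cells are carried to [nat] by [pickle]. Numbers that
    encode no index get a degenerate box at 0, because the corners must be ordered at every
    index. *)
Lemma lebesgue_null_cover m (E : set 'cV[R]_m) :
  (forall eps : R, 0 < eps -> exists (I : countType) (D : set I) (a b : I -> 'cV[R]_m),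
    [/\ forall k i, a k i 0 <= b k i 0,
        E `<=` \bigcup_(k in D) box (a k) (b k) &
        (\esum_(k in D) (box_volume (a k) (b k))%:E <= eps%:E)%E]) ->
  lebesgue_null E.
Proof.
move=> h eps /h [I [D [a [b [ab cov vol]]]]].
pose lift0 (f : I -> 'cV[R]_m) n := oapp f 0 (unpickle n).
have lift0E f k : lift0 f (pickle k) = f k by rewrite /lift0 pickleK.
exists (pickle @` D), (lift0 a), (lift0 b); split.
- by move=> n i; rewrite /lift0; case: (unpickle n) => //= k; rewrite !mxE.
- move=> x /cov [k Dk xk]; exists (pickle k); first by exists k.
  by rewrite !lift0E.
- rewrite esum_image; last by move=> x y _ _; exact: (pcan_inj (@pickleK I)).
  by under eq_esum => k _ do rewrite !lift0E.
Qed.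

Lemma lebesgue_null_bigcup m (E : nat -> set 'cV[R]_m) :
  (forall k, lebesgue_null (E k)) -> lebesgue_null (\bigcup_k E k).
Proof.
move=> nE; apply: lebesgue_null_cover => eps eps0.
have epsk k : 0 < eps / (2 ^ k.+1)%:R by rewrite divr_gt0 // ltr0n expn_gt0.
have /choice [D /choice [a /choice [b abD]]] := fun k => nE k _ (epsk k).
exists (nat * nat)%type, ([set: nat] `*`` D), (fun k => a k.1 k.2), (fun k => b k.1 k.2).
split.
- by move=> [k l] i /=; have [] := abD k.
- move=> x [k _ Ex]; have [_ cov _] := abD k.
  by have [l Dl xl] := cov _ Ex; exists (k, l).
rewrite -(@esum_esum _ _ _ setT D (fun k l => (box_volume (a k l) (b k l))%:E)); last first.
  by move=> k l _ _; rewrite lee_fin box_volume_ge0 //; have [] := abD k.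
apply: le_trans (epsilon_trick0 xpredT (ltW eps0)).
rewrite nneseries_esumT; last by move=> k; rewrite lee_fin ltW.
by apply: le_esum => k _; have [] := abD k.
Qed.

Lemma lebesgue_null_countable_bigcup m (I : countType) (E : I -> set 'cV[R]_m) :
  (forall k, lebesgue_null (E k)) -> lebesgue_null (\bigcup_k E k).
Proof.
move=> nE; pose E' n := oapp E set0 (unpickle n).
apply: (@lebesgue_null_sub _ _ (\bigcup_n E' n)).
  by move=> x [k _ Ex]; exists (pickle k) => //; rewrite /E' pickleK.
apply: lebesgue_null_bigcup => n; rewrite /E'; case: (unpickle n) => //= eps eps0.
exists set0, (fun=> 0), (fun=> 0); split => //.
by rewrite esum_set0 lee_fin ltW.
Qed.

(** Compactness of [0, 1] thickens the covering of the section: around a parameter in [U] there is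
    room since [U] is open, and around any other parameter the segment stays away from the closed
    set [K]. Including all [s] near [u] later puts whole grid cells into [U]. *)
Lemma closed_section_cover m (K : set 'cV[R]_m) (v y : 'cV[R]_m) (eps : R) :
  closed K -> 0 < eps ->
  mu.-negligible [set u : R | 0 <= u <= 1 /\ K (y + u *: v)] ->
  exists (U : set R) (eta : R), [/\ open U, (mu U < eps%:E)%E, 0 < eta &
    forall u z, 0 <= u <= 1 -> K z -> `|z - (y + u *: v)| < eta ->
      forall s, `|s - u| < eta -> U s].
Proof.
move=> Kc eps0 /(negligible_open_cover eps0) [U [oU KU Ueps]].
pose P eta u := forall z, K z -> `|z - (y + u *: v)| < eta ->
      forall s, `|s - u| < eta -> U s.
have /compact_near_coveringP cpt := @segment_compact R 0 1.
have nearP : \forall eta \near (0 : R)^'+, `[0, 1]%classic `<=` P eta.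
  apply: cpt => u /= u01; rewrite in_itv /= in u01.
  have [Uu|nUu] := pselect (U u).
    have /nbhs_normP [d /= d0 dU] : nbhs u U by exact: open_nbhs_nbhs.
    exists (ball_ Num.norm u (d / 2), [set eta | eta < d / 2]).
      split; first by apply/nbhs_normP; exists (d / 2) => //=; rewrite divr_gt0.
      by apply: nbhs_right_lt; rewrite divr_gt0.
    move=> [u' eta] [/= uu' eta_d] z _ _ s su'; apply: dU => /=.
    rewrite (le_lt_trans (ler_distD u' _ _)) // [ltRHS]splitr ltrD // distrC.
    exact: lt_trans eta_d.
  have nK : ~ K (y + u *: v) by move=> Kyu; apply/nUu/KU.
  have : nbhs (y + u *: v) (~` K) by apply: open_nbhs_nbhs; split => //; exact: closed_openC.
  move=> /nbhs_normP [d /= d0 dK].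
  have v1 : 0 < `|v| + 1 by rewrite ltr_wpDl.
  have e0 : 0 < d / 2 / (`|v| + 1) by rewrite !divr_gt0.
  exists (ball_ Num.norm u (d / 2 / (`|v| + 1)), [set eta | eta < d / 2]).
    split; first by apply/nbhs_normP; exists (d / 2 / (`|v| + 1)).
    by apply: nbhs_right_lt; rewrite divr_gt0.
  move=> [u' eta] [/= uu' eta_d] z Kz zu' s _; exfalso; apply: (dK z) => //=.
  rewrite (le_lt_trans (ler_distD (y + u' *: v) _ _)) // [ltRHS]splitr ltrD //; last first.
    by rewrite distrC (lt_trans zu').
  rewrite opprD addrACA subrr add0r -scalerBl normrZ.
  rewrite (@le_lt_trans _ _ (`|u - u'| * (`|v| + 1))) //.
    by rewrite ler_wpM2l // lerDl.
  by rewrite -ltr_pdivlMr.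
near (0 : R)^'+ => eta; exists U, eta; split => //.
have Peta : `[0, 1]%classic `<=` P eta by near: eta.
by move=> u z u01; apply: Peta; rewrite /= in_itv.
Unshelve. all: by end_near. Qed.

(** The set [U] found for [y] still serves nearby base points at half the thickness, so compactness
    of the ball gives an [eta] common to all of them. *)
Lemma closed_sections_uniform_cover m (K : set 'cV[R]_m) (v : 'cV[R]_m) (c eps : R) :
  closed K -> 0 < eps ->
  (forall y, mu.-negligible [set u : R | 0 <= u <= 1 /\ K (y + u *: v)]) ->
  exists2 eta : R, 0 < eta & forall y, `|y| <= c ->
    exists U : set R, [/\ open U, (mu U < eps%:E)%E &
      forall u z, 0 <= u <= 1 -> K z -> `|z - (y + u *: v)| < eta ->
        forall s, `|s - u| < eta -> U s].
Proof.
move=> Kc eps0 Kneg.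
pose P eta (y : 'cV[R]_m) := exists U : set R, [/\ open U, (mu U < eps%:E)%E &
      forall u z, 0 <= u <= 1 -> K z -> `|z - (y + u *: v)| < eta ->
        forall s, `|s - u| < eta -> U s].
have /compact_near_coveringP cpt := @mx_ball_compact R m 1 c.
have nearP : \forall eta \near (0 : R)^'+, [set y : 'cV[R]_m | `|y| <= c] `<=` P eta.
  apply: cpt => y _.
  have [U [e [oU Ueps e0 eU]]] := closed_section_cover Kc eps0 (Kneg y).
  exists (ball_ Num.norm y (e / 2), [set eta | eta < e / 2]).
    split; first by apply: (proj2 (nbhs_normP y _)); exists (e / 2) => //=; rewrite divr_gt0.
    by apply: nbhs_right_lt; rewrite divr_gt0.
  move=> [y' eta] [/= yy' eta_e]; exists U; split => // u z u01 Kz zu s su.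
  apply: (eU u z) => //.
    rewrite (le_lt_trans (ler_distD (y' + u *: v) _ _)) // [ltRHS]splitr ltrD //.
      exact: lt_trans eta_e.
    by rewrite opprD addrACA subrr addr0 distrC.
  by rewrite (lt_le_trans su) // (le_trans (ltW eta_e)) // ler_pdivrMr // ler_pMr // ler1n.
near (0 : R)^'+ => eta; exists eta => // y yc.
have Peta : [set y : 'cV[R]_m | `|y| <= c] `<=` P eta by near: eta.
exact: Peta.
Unshelve. all: by end_near. Qed.

Lemma grid_cell (N : nat) (x : R) : (0 < N)%N -> 0 <= x <= 1 ->
  exists k : 'I_N, k%:R / N%:R <= x <= k.+1%:R / N%:R.
Proof.
case: N => // N _ /andP[x0 x1].
have N0 : 0 < N.+1%:R :> R by rewrite ltr0n.
(* At [x = 1] the truncation would point one cell past the last, so the last closed cell is used. *)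
have [/eqP ->|x1'] := boolP (x == 1).
  by exists ord_max; rewrite ler_pdivrMr // mul1r ler_nat leqnSn divff ?gt_eqF //= lexx.
have xN0 : 0 <= x * N.+1%:R by rewrite mulr_ge0.
have /andP[kx xk] := Num.Theory.truncn_itv xN0.
have kN : (Num.truncn (x * N.+1%:R) < N.+1)%N.
  rewrite -(ltr_nat R) (le_lt_trans kx) // gtr_pMl //.
  by rewrite lt_neqAle x1' x1.
exists (Ordinal kN) => /=.
by rewrite ler_pdivrMr // kx ler_pdivlMr // ltW.
Qed.

(** The half-open cells are disjoint subsets of [U], each of measure 1 / N. *)
Lemma card_grid_cells_le (N : nat) (T : {pred 'I_N}) (U : set R) (eps : R) :
  (0 < N)%N -> open U -> (mu U < eps%:E)%E ->
  (forall t : 'I_N, t \in T -> forall s, t%:R / N%:R <= s <= t.+1%:R / N%:R -> U s) ->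
  #|T|%:R <= eps * N%:R.
Proof.
move=> N0 oU Ueps TU.
have N0' : 0 < N%:R :> R by rewrite ltr0n.
pose I (t : 'I_N) := `[t%:R / N%:R, t.+1%:R / N%:R[%classic : set R.
have mI t : measurable (I t) by exact: measurable_itv.
have tI : trivIset [set: 'I_N] I.
  apply/trivIsetP => t t' _ _ tt'; apply/seteqP; split => // s [].
  rewrite /I /= !in_itv /= => /andP[h1 h2] /andP[h3 h4].
  have {}h1 := le_lt_trans h1 h4; have {}h2 := le_lt_trans h3 h2.
  rewrite ltr_pM2r ?invr_gt0 // ltr_nat ltnS in h1.
  rewrite ltr_pM2r ?invr_gt0 // ltr_nat ltnS in h2.
  by move/eqP: tt'; apply; apply/val_inj/eqP; rewrite eqn_leq h1 h2.
have : (mu (\big[setU/set0]_(t < N | t \in T) I t) <= eps%:E)%E.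
  rewrite (le_trans _ (ltW Ueps)) // le_measure ?inE //.
  - by apply: bigsetU_measurable => t _; exact: mI.
  - exact: measurable_realfun.open_measurable.
  - rewrite -bigcup_seq_cond => s [t /= /andP[_ tT]].
    rewrite /I /= in_itv /= => /andP[h1 h2]; apply: (TU t) => //.
    by rewrite h1 ltW.
rewrite measure_bigsetU_ord //.
rewrite (eq_bigr (fun=> (N%:R^-1)%:E)); last first.
  move=> t _; transitivity (mu (I t)) => //; rewrite /I lebesgue_measure_itv /= lte_fin.
  rewrite ltr_pM2r ?invr_gt0 // ltr_nat ltnSn -EFinB -mulrBl.
  by rewrite -natrB // subSnn mul1r.
rewrite sumEFin sumr_const lee_fin => h.
by rewrite -ler_pdivrMr // mulr_natl.
Qed.

(* Elementary Fubini: when the cube [-c, c]^m is cut into a sufficiently fine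
   grid, each column of cells parallel to e_j has few cells that meet K. *)
Lemma lebesgue_null_sections m (j : 'I_m) (K : set 'cV[R]_m) (c : R) :
  0 < c -> closed K -> (forall x, K x -> `|x| <= c) ->
  (forall y, mu.-negligible
    [set u : R | 0 <= u <= 1 /\ K (y + u *: ((2 * c) *: delta_mx j 0))]) ->
  lebesgue_null K.
Proof.
case: m j K => [[]//|m] j K c0 Kc Kbd Kneg.
apply: lebesgue_null_cover => eps0 eps00.
pose w := 2 * c; have w0 : 0 < w by rewrite mulr_gt0.
(* There will be N ^ m columns with at most [eps * N] cells each, and a cell has volume (w / N) ^ (m
   + 1): the total is [eps * w ^+ m.+1]. *)
pose eps := eps0 / w ^+ m.+1.
have eps_gt0 : 0 < eps by rewrite divr_gt0 // exprn_gt0.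
have [eta eta0 etaP] := closed_sections_uniform_cover c Kc eps_gt0 Kneg.
(* A cell must be smaller than [eta] both as an interval of parameters (1 / N) and in space (w /
   N). *)
have [N [N0 Neta1 Neta2]] : exists N : nat,
    [/\ (0 < N)%N, N%:R^-1 < eta & w / N%:R < eta].
  have d0 : 0 < Num.min eta (eta / w) by rewrite lt_min eta0 divr_gt0.
  exists (Num.truncn (Num.min eta (eta / w))^-1).+1; set d := Num.min _ _ in d0 *.
  have dN : (Num.truncn d^-1).+1%:R^-1 < d.
    rewrite -[ltRHS]invrK ltf_pV2 ?posrE ?invr_gt0 //.
    have d'0 : 0 <= d^-1 by rewrite invr_ge0 ltW.
    by have /andP[] := Num.Theory.truncn_itv d'0.
  split => //; first by rewrite (lt_le_trans dN) // ge_min lexx.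
  by rewrite mulrC -ltr_pdivlMr // (lt_le_trans dN) // ge_min lexx orbT.
have N0' : 0 < N%:R :> R by rewrite ltr0n.
(* A cell is a column [bt.1], given by the coordinates other than [j], together with its height
   [bt.2] along [j]. *)
pose idx (bt : {ffun 'I_m -> 'I_N} * 'I_N) (i : 'I_m.+1) : 'I_N :=
  oapp bt.1 bt.2 (unlift j i).
pose lo bt : 'cV[R]_m.+1 := \col_i (- c + w * ((idx bt i)%:R / N%:R)).
pose hi bt : 'cV[R]_m.+1 := \col_i (- c + w * ((idx bt i).+1%:R / N%:R)).
pose D := [set bt | (K `&` box (lo bt) (hi bt)) !=set0].
exists ({ffun 'I_m -> 'I_N} * 'I_N)%type, D, lo, hi.
have lohi bt i : hi bt i 0 - lo bt i 0 = w / N%:R.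
  rewrite !mxE -addn1 natrD; field.
  by rewrite gt_eqF.
have wN0 : 0 < w / N%:R by rewrite divr_gt0.
split.
- by move=> bt i; rewrite -subr_ge0 lohi ltW.
- move=> x Kx.
  have /choice [k kx] : forall i, exists k : 'I_N,
      k%:R / N%:R <= (x i 0 + c) / w <= k.+1%:R / N%:R.
    move=> i; apply: grid_cell => //.
    have := le_trans (mx_entry_le x i 0) (Kbd _ Kx); rewrite ler_norml => /andP[x1 x2].
    rewrite ler_pdivlMr // ler_pdivrMr // /w; lra.
  pose bt := ([ffun i' => k (lift j i')], k j).
  have idxE i : idx bt i = k i.
    rewrite /idx /bt /=; case: unliftP => [i' ->|->] //=; by rewrite ffunE.
  have xbox : box (lo bt) (hi bt) x.
    move=> i; rewrite !mxE idxE; have /andP[] := kx i.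
    rewrite ler_pdivlMr // ler_pdivrMr //; lra.
  by exists bt => //; exists x.
rewrite esum_fset; last 2 first.
- exact: finite_finset.
- by move=> bt _; rewrite lee_fin box_volume_ge0 // => i; rewrite -subr_ge0 lohi ltW.
have volE bt : box_volume (lo bt) (hi bt) = (w / N%:R) ^+ m.+1.
  by rewrite /box_volume (eq_bigr (fun=> w / N%:R)) // prodr_const card_ord.
rewrite (eq_fsbigr (fun=> ((w / N%:R) ^+ m.+1)%:E)); last by move=> bt _; rewrite volE.
have colP (b : {ffun 'I_m -> 'I_N}) :
    #|[pred t : 'I_N | (b, t) \in D]|%:R <= eps * N%:R.
  (* The foot of the column: the default 0 places coordinate [j] at [- c]. *)
  pose y : 'cV[R]_m.+1 := 
    \col_i (- c + w * oapp (fun i' => (b i')%:R / N%:R) 0 (unlift j i)).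
  have yc : `|y| <= c.
    apply: mx_norm_leP => [|i l]; first exact: ltW.
    rewrite mxE; set o := oapp _ _ _; have /andP[q0 q1] : 0 <= o <= 1.
      rewrite /o; case: (unlift j i) => [i'|] /=; last by rewrite lexx ler01.
      by rewrite divr_ge0 //= ler_pdivrMr // mul1r ler_nat ltnW.
    by rewrite ler_norml /w; nra.
  have [U [oU Ueps HU]] := etaP y yc.
  apply: (card_grid_cells_le (U := U)) => // t.
  move=> /set_mem [z [Kz zbox]] s /andP[ts st].
  have t01 : 0 <= (t%:R / N%:R : R) <= 1.
    by rewrite divr_ge0 //= ler_pdivrMr // mul1r ler_nat ltnW.
  apply: (HU (t%:R / N%:R) z) => //; last first.
    rewrite ger0_norm ?subr_ge0 // (le_lt_trans _ Neta1) //.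
    have : t.+1%:R / N%:R = t%:R / N%:R + N%:R^-1 :> R.
      by rewrite -addn1 natrD mulrDl mul1r.
    lra.
  apply: le_lt_trans Neta2; apply: mx_norm_leP => [|i l]; first exact: ltW.
  rewrite ord1; set pt := y + _.
  (* The line from [y] reaches the lower corner of the cell at parameter t / N, hence comes within w
     / N of the point of [K] in that cell. *)
  have -> : pt = lo (b, t).
    apply/colP => i'; rewrite /pt /y /lo !mxE eqxx andbT /idx /=.
    case: unliftP => [i''|] ->; rewrite ?eqxx /=.
      by rewrite eq_sym (negbTE (neq_lift _ _)) !mulr0 addr0.
    by rewrite mulr0 addr0 mulr1 mulrC.
  rewrite !mxE; have := lohi (b, t) i; have := zbox i; rewrite !mxE => /andP[z1 z2] h.
  by rewrite ger0_norm ?subr_ge0 //; lra.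
set C := (w / N%:R) ^+ m.+1.
have C0 : 0 <= C by rewrite exprn_ge0 // ltW.
have -> : (\sum_(bt \in D) C%:E)%E = (\sum_(bt | bt \in D) C)%:E.
  rewrite -sumEFin [RHS]bigfs ?index_enum_uniq ?set_mem_set // => bt _.
  by rewrite mem_index_enum.
rewrite lee_fin (eq_bigl (fun bt => xpredT bt.1 && ((bt.1, bt.2) \in D))); last by case.
rewrite -(pair_big_dep xpredT (fun b t => (b, t) \in D) (fun _ _ => C)) /=.
rewrite (@le_trans _ _ (\sum_(b : {ffun 'I_m -> 'I_N}) eps * N%:R * C)) //.
  by apply: ler_sum => b _; rewrite sumr_const -[leLHS]mulr_natl ler_wpM2r // colP.
rewrite sumr_const card_ffun !card_ord -[leLHS]mulr_natl natrX /C /eps expr_div_n !exprSr.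
rewrite le_eqVlt; apply/orP; left; apply/eqP; field.
by rewrite !expf_neq0 ?gt_eqF.
Qed.

End NullSets.

(** * Derivatives along lines and upper semicontinuity of conservative Jacobians *)

Section ConservativeJacobians.
Set Implicit Arguments.
Unset Strict Implicit.
Variable R : realType.
Local Notation mu := (@lebesgue_measure R).

Lemma differentiable_linear_approx (V W : normedModType R) (f : V -> W)
    (df : {linear V -> W}) x : continuous df ->
  (forall eps, 0 < eps -> \forall h \near 0,
    `|f (h + x) - (f x + df h)| <= eps * `|h|) ->
  differentiable f x /\ 'd f x = df :> (V -> W).
Proof.
move=> dfc h.
have dE : f \o shift x = cst (f x) + df +o_ 0 id by apply/eqaddoP => eps /h.
have dval := diff_unique dfc dE.
by split => //; apply/diff_locallyP; rewrite dval.
Qed.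

Lemma derive_line n (a v : 'cV[R]_n) (t : R) :
  derivable (fun t : R => a + t *: v) t 1 /\ 'D_1 (fun t : R => a + t *: v) t = v.
Proof.
suff h : (fun h : R => h^-1 *: (((fun t : R => a + t *: v) \o shift t) (h *: 1)
            - (a + t *: v))) @ 0^' --> v.
  by split; [apply/cvg_ex; exists v|exact: cvg_lim h].
apply: cvg_near_cst; near=> h.
have h0 : h != 0 by near: h; exact: nbhs_dnbhs_neq.
rewrite /= opprD addrACA subrr add0r -scalerBl [h%:A]mulr1 addrK.
by rewrite scalerA mulVf // scale1r.
Unshelve. all: by end_near. Qed.

Lemma derive_col_mx n r (f : R -> 'cV[R]_n) (g : R -> 'cV[R]_r) t :
  derivable (fun t => col_mx (f t) (g t)) t 1 ->
  [/\ derivable f t 1, derivable g t 1 &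
      'D_1 (fun t => col_mx (f t) (g t)) t = col_mx ('D_1 f t) ('D_1 g t)].
Proof.
move=> d.
have /derivable_mxP dij := d.
have df : derivable f t 1.
  apply/derivable_mxP => i j; have := dij (lshift r i) j.
  by under eq_fun do rewrite col_mxEu.
have dg : derivable g t 1.
  apply/derivable_mxP => i j; have := dij (rshift n i) j.
  by under eq_fun do rewrite col_mxEd.
split => //; rewrite !derive_mx //; apply/matrixP => i j.
by rewrite mxE; case: (split_ordP i) => k ->; under eq_fun do rewrite ?col_mxEu ?col_mxEd;
  rewrite ?col_mxEu ?col_mxEd mxE.
Qed.

Lemma locally_lipschitz_id n : locally_lipschitz (@id 'cV[R]_n).
Proof. by apply: locally_lipschitzI => x; exists 1, 1; split => // y z _ _; rewrite mul1r. Qed.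

Lemma conservative_jacobian_ae n q (f : 'cV[R]_n -> 'cV[R]_q) J gamma :
  conservative_jacobian f J -> locally_lipschitz01 gamma ->
  {ae mu, forall t : R, t \in `[0, 1] ->
      [/\ derivable gamma t 1, derivable (f \o gamma) t 1 &
          forall V, J (gamma t) V ->
            'D_1 (f \o gamma) t = V *m 'D_1 gamma t]}.
Proof.
move=> cJ lg; apply: (cj_chain_rule cJ); exact: absolutely_continuous_lipschitz01.
Qed.

(** Near [x], all values of [J] lie in one compact ball. A matrix of this ball either belongs to
    [J x], and its neighbours are then close to [J x], or is excluded together with its neighbours
    by the closed graph. *)
Lemma conservative_jacobian_usc n q (f : 'cV[R]_n -> 'cV[R]_q) J x eps :
  conservative_jacobian f J -> 0 < eps ->
  exists2 delta, 0 < delta & forall y, `|x - y| < delta ->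
    forall V, J y V -> exists2 V', J x V' & `|V - V'| < eps.
Proof.
move=> cJ eps0.
have [M /nbhs_normP [d0 /= d00 HM]] := cj_locally_bounded cJ x.
pose P y V := J y V -> exists2 V', J x V' & `|V - V'| < eps.
have /compact_near_coveringP cpt := @mx_ball_compact R q n M.
have : \forall y \near x, [set V : 'M[R]_(q, n) | `|V| <= M] `<=` P y.
  apply: (cpt _ (nbhs x) P) => V _; have [JV|nJV] := pselect (J x V).
    exists (ball_ Num.norm V eps, setT).
      by split; [apply: (proj2 (nbhs_normP V _)); exists eps|exact: filterT].
    by move=> [V' y] [/= VV' _] _; exists V => //; rewrite distrC.
  have : nbhs (x, V) (~` [set z : 'cV[R]_n * 'M[R]_(q, n) | J z.1 z.2]).
    by apply: open_nbhs_nbhs; split => //; apply: closed_openC; exact: cj_closed_graph cJ.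
  move=> [[A B] /= [xA VB] AB]; exists (B, A) => // -[V' y] [/= BV' Ay] JyV'.
  by have := AB (y, V') (conj Ay BV').
move=> /nbhs_normP [d1 /= d10 HP].
exists (Num.min d0 d1); first by rewrite lt_min d00.
move=> y; rewrite lt_min => /andP[y0 y1] V JV.
by apply: (HP y y1 V _ JV); exact: HM JV.
Qed.

End ConservativeJacobians.

(** * The fixed point and its derivative *)

Section ImplicitDerivative.
Set Implicit Arguments.
Unset Strict Implicit.
Variables (R : realType) (p m : nat).
Variables (F : 'cV[R]_(p + m) -> 'cV[R]_p).
Variables (JF : 'cV[R]_(p + m) -> set 'M[R]_(p, p + m)).
Hypothesis JFc : conservative_jacobian F JF.
Variable rho : R.
Hypotheses (rho0 : 0 <= rho) (rho1 : rho < 1).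
Hypothesis JF_rho : forall x theta (A : 'M[R]_p) (B : 'M[R]_(p, m)),
  JF (col_mx x theta) (row_mx A B) -> op_norm A <= rho.
Variable xbar : 'cV[R]_m -> 'cV[R]_p.
Hypothesis xbarE : forall theta, F (col_mx (xbar theta) theta) = xbar theta.

Local Notation mu := (@lebesgue_measure R).
Local Notation z theta := (col_mx (xbar theta) theta).

Let rho1' : 0 < 1 - rho. Proof. by rewrite subr_gt0. Qed.

Lemma JF_contract u V x : JF u V -> norm2 (lsubmx V *m x) <= rho * norm2 x.
Proof.
rewrite -[u]vsubmxK -[V in JF _ V]hsubmxK => JV.
by apply: op_norm_le; exact: JF_rho JV.
Qed.

(** A priori estimate from the triangle inequality; invertibility of [1 - A], stability of the
    solutions and differentiability of [xbar] all rest on it. *)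
Lemma contract_fixed (A : 'M[R]_p) (d b : 'cV[R]_p) :
  norm2 (A *m d) <= rho * norm2 d -> d = A *m d + b ->
  (1 - rho) * norm2 d <= norm2 b.
Proof.
by move=> Ad db; have := norm2D (A *m d) b; rewrite -db mulrBl; lra.
Qed.

Lemma F_contraction_le x y theta :
  norm2 (F (col_mx x theta) - F (col_mx y theta)) <= rho * norm2 (x - y).
Proof.
pose a := col_mx y theta; pose v := col_mx (x - y) (0 : 'cV[R]_m).
have lineE t : a + t *: v = col_mx (y + t *: (x - y)) theta.
  by rewrite scale_col_mx add_col_mx scaler0 addr0.
have -> : col_mx x theta = a + 1 *: v by rewrite lineE scale1r subrKC.
have -> : col_mx y theta = a + 0 *: v by rewrite scale0r addr0.
apply: (@norm2_increment_le _ _ (fun t => F (a + t *: v))).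
- by rewrite mulr_ge0 // norm2_ge0.
- exact: locally_lipschitz_line (cj_lipschitz JFc).
have := conservative_jacobian_ae JFc (locally_lipschitz_line a v (@locally_lipschitz_id R _)).
apply: (@filterS _ _ (ae_filter_ringOfSetsType mu)) => t h /h [_ dF DF]; split => //.
(* The direction has no component along theta, so only the block A of [V] acts. *)
have [V JV] := cj_nonempty JFc (a + t *: v).
rewrite (DF V) // (derive_line a v t).2 -[V]hsubmxK mul_row_col mulmx0 addr0.
exact: JF_contract JV.
Qed.

Lemma xbar_locally_lipschitz : locally_lipschitz xbar.
Proof.
pose C := Num.sqrt p%:R / (1 - rho).
have C0 : 0 <= C by rewrite divr_ge0 ?sqrtr_ge0 // ltW.
(* Stability of fixed points: the displacement is controlled by the change of [F] in theta alone, at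
   the fixed point of [th']. *)
have key th th' : `|xbar th - xbar th'| <=
    C * `|F (col_mx (xbar th') th) - F (col_mx (xbar th') th')|.
  rewrite (le_trans (norm2_ge_norm _)) // mulrAC ler_pdivlMr // mulrC.
  apply: le_trans (norm2_le_norm _).
  have := F_contraction_le (xbar th) (xbar th') th; rewrite xbarE.
  set u := F _ => h; have := norm2D (xbar th - u) (u - xbar th').
  by rewrite subrKA [in u - F _]xbarE mulrBl; lra.
apply: locally_lipschitzI => th.
have [r [L [r0 L0 FL]]] := locally_lipschitzE (cj_lipschitz JFc) (z th).
pose K := C * L + 1.
have K0 : 0 < K by rewrite ltr_wpDl // mulr_ge0 // ltW.
have K1 : C * L <= K by rewrite lerDl.
have colB (x : 'cV[R]_p) (t t' : 'cV[R]_m) :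
    `|col_mx x t - col_mx x t'| <= `|t - t'|.
  by rewrite opp_col_mx add_col_mx subrr col_mx_norm_le // normr0.
(* Comparison with the centre comes first: it keeps the points (xbar th1, th2) in the ball where [F]
   is Lipschitz, as the general comparison requires. *)
have near1 th' : `|th - th'| < r -> `|xbar th - xbar th'| <= K * `|th - th'|.
  move=> tr; rewrite distrC (le_trans (key _ _)) // (@le_trans _ _ (C * (L * `|th - th'|))) //.
    rewrite ler_wpM2l // (le_trans (FL _ _ _ _)) //; rewrite ?subrr ?normr0 //.
      by rewrite (le_lt_trans (colB _ _ _)).
    by rewrite ler_pM2l // (le_trans (colB _ _ _)) // distrC.
  by rewrite mulrA ler_wpM2r.
have K1' : 1 <= K by rewrite lerDr mulr_ge0 // ltW.
have near2 th1 th2 : `|th - th1| < r / K -> `|th - th2| < r / K ->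
    `|z th - col_mx (xbar th1) th2| < r.
  rewrite !ltr_pdivlMr // ![_ * K]mulrC => h1 h2.
  have h1' : `|th - th1| < r by apply: le_lt_trans h1; rewrite ler_peMl.
  have h2' : `|th - th2| < r by apply: le_lt_trans h2; rewrite ler_peMl.
  rewrite opp_col_mx add_col_mx.
  apply: (@le_lt_trans _ _ (Num.max (K * `|th - th1|) `|th - th2|)); last by rewrite gt_max h1.
  by apply: col_mx_norm_le; rewrite le_max ?lexx ?orbT ?near1.
exists (r / K), K; split => //; first by rewrite divr_gt0.
move=> th1 th2 h1 h2.
rewrite (le_trans (key _ _)) // (@le_trans _ _ (C * (L * `|th1 - th2|))) //.
  rewrite ler_wpM2l // (le_trans (FL _ _ (near2 _ _ h2 h1) (near2 _ _ h2 h2))) //.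
  by rewrite ler_pM2l // colB.
by rewrite mulrA ler_wpM2r.
Qed.

Lemma z_locally_lipschitz : locally_lipschitz (fun theta => z theta).
Proof.
apply: locally_lipschitzI => th.
have [r [L [r0 L0 xL]]] := locally_lipschitzE xbar_locally_lipschitz th.
exists r, (L + 1); split => // [|y y' yr y'r]; first by rewrite addr_gt0.
rewrite opp_col_mx add_col_mx col_mx_norm_le //.
  by rewrite (le_trans (xL _ _ yr y'r)) // ler_wpM2r // lerDl.
by rewrite ler_peMl // lerDr ltW.
Qed.

Lemma xbar_line_ae (y v : 'cV[R]_m) :
  {ae mu, forall t : R, t \in `[0, 1] ->
    derivable (fun t : R => xbar (y + t *: v)) t 1 /\
    forall V, JF (z (y + t *: v)) V ->
      'D_1 (fun t : R => xbar (y + t *: v)) t =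
      lsubmx V *m 'D_1 (fun t : R => xbar (y + t *: v)) t + rsubmx V *m v}.
Proof.
have := conservative_jacobian_ae JFc (locally_lipschitz_line y v z_locally_lipschitz).
apply: (@filterS _ _ (ae_filter_ringOfSetsType mu)) => t h /h [dz _ DF].
have [dx _ Dz] := derive_col_mx dz; split => // V JV.
have := DF V JV; rewrite Dz (derive_line y v t).2 -[V in V *m _]hsubmxK mul_row_col => <-.
by congr ('D_1 _ t); apply/funext => s; rewrite /= xbarE.
Qed.

(* The equation obtained by formally differentiating xbar = F (xbar, theta) in
   the direction e. *)
Definition dir_candidate theta (e : 'cV[R]_m) d : Prop :=
  exists2 V, JF (z theta) V & d = lsubmx V *m d + rsubmx V *m e.

(** The a priori estimate with zero right-hand side gives [1 - A] a trivial kernel. [E] is a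
    direction when n = 1 and the identity when the full matrix is wanted. *)
Lemma candidate_exists u V n (E : 'M[R]_(m, n)) : JF u V ->
  exists D : 'M[R]_(p, n), D = lsubmx V *m D + rsubmx V *m E.
Proof.
move=> JV; pose A := lsubmx V.
have uA : 1%:M - A \in unitmx.
  rewrite -unitmx_tr -row_free_unit; apply: inj_row_free => v.
  move=> /(congr1 trmx); rewrite trmx_mul trmxK trmx0 mulmxBl mul1mx => /subr0_eq vE.
  have := @contract_fixed A v^T 0 (JF_contract _ JV); rewrite addr0 => /(_ vE).
  rewrite norm20 pmulr_rle0 // => h.
  apply/trmx_inj; rewrite trmx0; apply: norm2_eq0.
  by apply/eqP; rewrite eq_le h norm2_ge0.
exists (invmx (1%:M - A) *m (rsubmx V *m E)); set D := _ *m _.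
have : (1%:M - A) *m D = rsubmx V *m E by rewrite mulKVmx.
by rewrite mulmxBl mul1mx => /eqP; rewrite subr_eq addrC => /eqP.
Qed.

(** The difference [d - d'] solves the equation of V' with right-hand side (A - A') d + (B - B') e.
    The case V = V' is uniqueness. *)
Lemma candidate_dist u u' V V' (e : 'cV[R]_m) (d d' : 'cV[R]_p) : JF u V -> JF u' V' ->
  d = lsubmx V *m d + rsubmx V *m e -> d' = lsubmx V' *m d' + rsubmx V' *m e ->
  (1 - rho) * `|d - d'| <=
  Num.sqrt p%:R * (`|V - V'| * (p%:R * `|d| + m%:R * `|e|)).
Proof.
move=> JV JV' dE d'E.
apply: (@le_trans _ _ ((1 - rho) * norm2 (d - d'))).
  by rewrite ler_pM2l // norm2_ge_norm.
have h : d - d' = lsubmx V' *m (d - d') + (lsubmx (V - V') *m d + rsubmx (V - V') *m e).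
  rewrite !linearB /= {1}dE {1}d'E !mulmxBl.
  move: (_ *m d) (_ *m e) (_ *m d') (_ *m e) (_ *m d) => v1 v2 v3 v4 v5.
  by apply/colP => i; rewrite !mxE; ring.
apply: (le_trans (contract_fixed (JF_contract _ JV') h)).
rewrite (le_trans (norm2_le_norm _)) // ler_wpM2l ?sqrtr_ge0 //.
rewrite (le_trans (ler_normD _ _)) // mulrDr lerD //.
  rewrite (le_trans (mulmx_norm_le _ _)) // mulrCA ler_wpM2r ?mulr_ge0 //.
  by rewrite -[X in _ <= `|X|]hsubmxK row_mx_norm_l.
rewrite (le_trans (mulmx_norm_le _ _)) // mulrCA ler_wpM2r ?mulr_ge0 //.
by rewrite -[X in _ <= `|X|]hsubmxK row_mx_norm_r.
Qed.


Lemma candidate_bound u V (e : 'cV[R]_m) (d : 'cV[R]_p) : JF u V ->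
  d = lsubmx V *m d + rsubmx V *m e ->
  (1 - rho) * `|d| <= Num.sqrt p%:R * (m%:R * (`|V| * `|e|)).
Proof.
move=> JV dE; apply: (@le_trans _ _ ((1 - rho) * norm2 d)).
  by rewrite ler_pM2l // norm2_ge_norm.
apply: (le_trans (contract_fixed (JF_contract _ JV) dE)).
rewrite (le_trans (norm2_le_norm _)) // ler_wpM2l ?sqrtr_ge0 //.
rewrite (le_trans (mulmx_norm_le _ _)) // ler_wpM2l // ler_wpM2r //.
by rewrite -[X in _ <= `|X|]hsubmxK row_mx_norm_r.
Qed.

Lemma candidate_unique u V (e : 'cV[R]_m) (d d' : 'cV[R]_p) : JF u V ->
  d = lsubmx V *m d + rsubmx V *m e -> d' = lsubmx V *m d' + rsubmx V *m e ->
  d = d'.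
Proof.
move=> JV dE d'E; have := candidate_dist JV JV dE d'E.
rewrite subrr normr0 mul0r mulr0 pmulr_rle0 // normr_le0 subr_eq0.
by move/eqP.
Qed.

(** A quantitative gap, unlike mere distinctness, survives when theta tends to a limit. *)
Definition ambiguous (e : 'cV[R]_m) (eta : R) : set 'cV[R]_m :=
  [set theta | exists d d', [/\ dir_candidate theta e d,
     dir_candidate theta e d' & eta <= `|d - d'|]].

Lemma z_near theta eps : 0 < eps -> exists2 r, 0 < r &
  forall theta', `|theta - theta'| < r -> `|z theta - z theta'| < eps.
Proof.
move=> eps0; have [r [L [r0 L0 zL]]] := locally_lipschitzE z_locally_lipschitz theta.
exists (Num.min r (eps / L)); first by rewrite lt_min r0 divr_gt0.
move=> theta'; rewrite lt_min => /andP[h1 h2].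
rewrite (le_lt_trans (zL theta theta' _ h1)) ?subrr ?normr0 //.
by rewrite mulrC -ltr_pdivlMr.
Qed.

(** By upper semicontinuity, each of two candidates at a nearby th' is within eta / 4 of a candidate
    at theta, so the gap shrinks by at most eta / 2. *)
Lemma closure_ambiguous e eta : 0 < eta ->
  closure (ambiguous e eta) `<=` ambiguous e (eta / 2).
Proof.
move=> eta0 theta clth.
have [M /nbhs_normP [r0 /= r00 HM]] := cj_locally_bounded JFc (z theta).
pose K := Num.sqrt p%:R / (1 - rho).
have K0 : 0 <= K by rewrite divr_ge0 ?sqrtr_ge0 // ltW.
(* [Q] bounds all candidates near theta; [C] is the resulting Lipschitz factor in [candidate_dist],
   plus 1 to make it positive. *)
pose Q := K * (m%:R * (`|M| * `|e|)).
pose C := K * (p%:R * Q + m%:R * `|e|) + 1.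
have Q0 : 0 <= Q by rewrite mulr_ge0 // mulr_ge0 // mulr_ge0.
have C0 : 0 < C by rewrite ltr_wpDl // mulr_ge0 // addr_ge0 // mulr_ge0.
have eps0 : 0 < eta / 4 / C by rewrite !divr_gt0.
have [delta delta0 usc] := conservative_jacobian_usc (z theta) JFc eps0.
have min0 : 0 < Num.min delta r0 by rewrite lt_min delta0.
have [r rpos zr] := z_near theta min0.
have /clth [th' [[d [d' [[V JV dE] [V' JV' d'E] dd']]] /= thr]] :
    nbhs theta (ball_ Num.norm theta r).
  by apply: (proj2 (nbhs_normP theta _)); exists r.
have := zr _ thr; rewrite lt_min => /andP[zd zr0].
have near_candidate W c : JF (z th') W -> c = lsubmx W *m c + rsubmx W *m e ->
    exists2 c', dir_candidate theta e c' & `|c - c'| <= eta / 4.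
  move=> JW cE; have [W' JW' WW'] := usc _ zd _ JW.
  have [c' c'E] := candidate_exists e JW'.
  exists c'; first by exists W'.
  have cQ : `|c| <= Q.
    have := candidate_bound JW cE; rewrite mulrC -ler_pdivlMr // => /le_trans; apply.
    rewrite mulrAC -/K ler_wpM2l // ler_wpM2l // ler_wpM2r //.
    by rewrite (le_trans (HM _ zr0 _ JW)) // ler_norm.
  have := candidate_dist JW JW' cE c'E; rewrite mulrC -ler_pdivlMr // => /le_trans; apply.
  rewrite mulrAC -/K mulrCA.
  apply: (@le_trans _ _ (eta / 4 / C * C)); last by rewrite divfK // gt_eqF.
  apply: ler_pM => //; [by rewrite mulr_ge0 // addr_ge0 // mulr_ge0|exact: ltW|].
  by rewrite /C ler_wpDr // ler_wpM2l // lerD2r ler_wpM2l.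
have [c cc dc] := near_candidate _ _ JV dE.
have [c' cc' dc'] := near_candidate _ _ JV' d'E.
exists c, c'; split => //.
have := ler_distD c d d'; have := ler_distD c' c d'.
rewrite (distrC c' d'); lra.
Qed.

Definition unambiguous theta := forall (j : 'I_m) (k : nat),
  ~ ambiguous (delta_mx j 0) k.+1%:R^-1 theta.

Lemma almost_all_unambiguous : for_almost_all unambiguous.
Proof.
(* The index holds the coordinate direction, the gap and the radius of a ball: each piece is closed
   and bounded. *)
pose K (i : 'I_m * nat * nat) := closure (ambiguous (delta_mx i.1.1 0) i.1.2.+1%:R^-1) `&`
  closed_ball_ Num.norm 0 (i.2.+1%:R : R).
apply: (@lebesgue_null_sub _ _ _ (\bigcup_i K i)).
  move=> th /= /existsNP [j /existsNP [k /contrapT amb]].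
  exists (j, k, Num.truncn `|th|) => //; split; first exact: subset_closure.
  rewrite /closed_ball_ /= sub0r normrN ltW //.
  by have /andP[] := Num.Theory.truncn_itv (normr_ge0 th).
apply: lebesgue_null_countable_bigcup => -[[j k] c].
have c0 : 0 < c.+1%:R :> R by rewrite ltr0n.
have w0 : 0 < 2 * c.+1%:R :> R by rewrite mulr_gt0.
apply: (lebesgue_null_sections (j := j) c0).
- by apply: closedI; [exact: closed_closure|exact: closed_closed_ball_].
- by move=> x [_]; rewrite /closed_ball_ /= sub0r normrN.
move=> y; apply: negligibleS (xbar_line_ae y ((2 * c.+1%:R) *: delta_mx j 0)).
move=> t /= [t01 [Kt _]] H; have [_ {}H] := H t01.
have k0 : 0 < k.+1%:R^-1 :> R by rewrite invr_gt0.
have [d [d' [[V JV dE] [V' JV' d'E]]]] := closure_ambiguous k0 Kt.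
set D := 'D_1 _ t in H; set w := _ * _ in w0 H.
(* The line runs at speed [w], so its derivative is rescaled. It then solves the equation for every
   [W] at once, and both candidates must equal it. *)
have cD W : JF (z (y + t *: (w *: delta_mx j 0))) W ->
    w^-1 *: D = lsubmx W *m (w^-1 *: D) + rsubmx W *m delta_mx j 0.
  move=> /H {1}->; rewrite scalerDr -!scalemxAr scalerA mulVf ?gt_eqF //.
  by rewrite scale1r.
rewrite (candidate_unique JV dE (cD _ JV)) (candidate_unique JV' d'E (cD _ JV')).
by rewrite subrr normr0 leNgt divr_gt0.
Qed.

Lemma unambiguous_solution theta : unambiguous theta ->
  exists D : 'M[R]_(p, m), forall V, JF (z theta) V -> D = lsubmx V *m D + rsubmx V.
Proof.
move=> unamb; have [V0 JV0] := cj_nonempty JFc (z theta).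
have [D DE] := candidate_exists 1%:M JV0.
exists D => V JV; have [D' D'E] := candidate_exists 1%:M JV.
suff -> : D = D' by rewrite {1}D'E mulmx1.
have mulE (E : 'M[R]_(p, m)) i j : E i j = (E *m delta_mx j (0 : 'I_1)) i 0.
  by rewrite -colE mxE.
apply/matrixP => i j; rewrite !mulE; congr ((_ : 'cV[R]_p) i 0).
apply/eqP; rewrite -subr_eq0 -normr_le0 leNgt; apply/negP => d0.
have {}d0' := d0; set x := `|_| in d0.
(* If column [j] differs by [x], this index gives a gap 1 / (k + 1) below [x]. *)
apply: (unamb j (Num.truncn x^-1)).
exists (D *m delta_mx j 0), (D' *m delta_mx j 0); split.
- by exists V0 => //; rewrite {1}DE mulmx1 mulmxDl mulmxA.
- by exists V => //; rewrite {1}D'E mulmx1 mulmxDl mulmxA.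
rewrite -/x -[leRHS]invrK lef_pV2 ?posrE ?invr_gt0 // ltW //.
have x0 : 0 <= x^-1 by rewrite invr_ge0 ltW.
by have /andP[] := Num.Theory.truncn_itv x0.
Qed.

Lemma residual_near theta (D : 'M[R]_(p, m)) eps :
  (forall V, JF (z theta) V -> D = lsubmx V *m D + rsubmx V) -> 0 < eps ->
  exists2 delta, 0 < delta & forall y, `|z theta - y| < delta ->
    forall V, JF y V -> `|lsubmx V *m D + rsubmx V - D| <= eps.
Proof.
move=> DE eps0.
pose C := p%:R * `|D| + 1.
have C0 : 0 < C by rewrite ltr_wpDl // mulr_ge0.
have eC : 0 < eps / C by rewrite divr_gt0.
have [delta delta0 usc] := conservative_jacobian_usc (z theta) JFc eC.
exists delta => // y yd V JV; have [V' JV' VV'] := usc _ yd _ JV.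
have -> : lsubmx V *m D + rsubmx V - D =
    lsubmx (V - V') *m D + rsubmx (V - V').
  by rewrite {2}(DE _ JV') !linearB /= !mulmxBl opprD addrACA.
rewrite (le_trans (ler_normD _ _)) // (@le_trans _ _ (`|V - V'| * C)) //.
  rewrite mulrDr mulr1 lerD //; last by rewrite -[X in _ <= `|X|]hsubmxK row_mx_norm_r.
  rewrite (le_trans (mulmx_norm_le _ _)) // mulrCA ler_wpM2r ?mulr_ge0 //.
  by rewrite -[X in _ <= `|X|]hsubmxK row_mx_norm_l.
by rewrite -ler_pdivlMr // ltW.
Qed.

(** Along the segment to theta + h, the error [xbar (theta + t *: h) - t *: (D *m h)] has almost
    everywhere a derivative solving d = A d + (A D + B - D) h. The residual is small near theta, so
    this derivative is small compared with h, and the mean value inequality bounds the increment. *)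
Lemma xbar_differentiable theta (D : 'M[R]_(p, m)) :
  (forall V, JF (z theta) V -> D = lsubmx V *m D + rsubmx V) ->
  differentiable xbar theta /\ jac xbar theta = D.
Proof.
move=> DE.
pose df : {linear 'cV[R]_m -> 'cV[R]_p} := mulmx D.
have Dc : continuous df.
  apply/linear_bounded_continuous/linear_boundedP.
  apply: (filterS _ (nbhs_pinfty_ge (num_real (m%:R * `|D|)))) => r /= Dr x.
  by rewrite (le_trans (mulmx_norm_le _ _)) // mulrA ler_wpM2r.
suff [dx dval] : differentiable xbar theta /\ 'd xbar theta = df :> (_ -> _).
  by split => //; apply/matrixP => i j; rewrite mxE dval /df /= -colE mxE.
apply: differentiable_linear_approx => // eps eps0.
  pose C := Num.sqrt p%:R * m%:R / (1 - rho) + 1.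
  have C0 : 0 < C by rewrite ltr_wpDl // divr_ge0 ?mulr_ge0 ?sqrtr_ge0 // ltW.
  have eC : 0 < eps / C by rewrite divr_gt0.
  have [delta delta0 res] := residual_near DE eC.
  have [r r0 zr] := z_near theta delta0.
  apply: (proj2 (nbhs_normP (0 : 'cV[R]_m) _)); exists r => // h /=.
  rewrite sub0r normrN => hr.
  pose g (t : R) := xbar (theta + t *: h) - t *: (D *m h).
  change (`|xbar (h + theta) - (xbar theta + D *m h)| <= eps * `|h|).
  have -> : xbar (h + theta) - (xbar theta + D *m h) = g 1 - g 0.
    rewrite /g !scale1r !scale0r addr0 subr0 (addrC theta).
    by rewrite [RHS]addrAC opprD addrA.
  rewrite (le_trans (norm2_ge_norm _)) //.
  pose c := Num.sqrt p%:R * (m%:R * (eps / C * `|h|)) / (1 - rho).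
  have c0 : 0 <= c by rewrite divr_ge0 ?mulr_ge0 ?sqrtr_ge0 ?invr_ge0 // ltW.
  apply: (@le_trans _ _ c); last first.
    rewrite /c; apply: (@le_trans _ _ (eps / C * (C * `|h|))); last first.
      by rewrite mulrA divfK // gt_eqF.
    rewrite (_ : _ / (1 - rho) =
      eps / C * (Num.sqrt p%:R * m%:R / (1 - rho) * `|h|)); last by ring.
    by rewrite ler_wpM2l ?(ltW eC) // ler_wpM2r // lerDl.
  apply: norm2_increment_le => //.
    have [d [L [d0 L0 xL]]] := locally_lipschitz_line theta h xbar_locally_lipschitz.
    exists d, (L + `|D *m h|); split => //; first by rewrite addr_ge0.
    move=> s t s01 t01 st; rewrite /g opprD addrACA -opprD -scalerBl mulrDl.
    by rewrite (le_trans (ler_normB _ _)) // normrZ lerD ?xL // mulrC.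
  move: (xbar_line_ae theta h).
  apply: (@filterS _ _ (ae_filter_ringOfSetsType mu)) => t H t01.
  have [dx Dx] := H t01.
  have [dl Dl] := derive_line 0 (D *m h) t.
  have gE : g = (fun t : R => xbar (theta + t *: h)) - (fun t : R => 0 + t *: (D *m h)).
    apply/funext => s.
    by change (g s = xbar (theta + s *: h) - (0 + s *: (D *m h))); rewrite add0r.
  rewrite gE; split; first exact: derivableB.
  rewrite deriveB // Dl.
  have [V JV] := cj_nonempty JFc (z (theta + t *: h)).
  have := Dx V JV; set X := 'D_1 _ t => XE.
  have YE : X - D *m h = lsubmx V *m (X - D *m h) +
      (lsubmx V *m D + rsubmx V - D) *m h.
    rewrite {1}XE mulmxBr !mulmxBl mulmxDl mulmxA.
    by move: (_ *m X) (_ *m h) (_ *m h) (_ *m h) => v1 v2 v3 v4;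
      apply/colP => i; rewrite !mxE; ring.
  rewrite /c ler_pdivlMr // mulrC (le_trans (contract_fixed (JF_contract _ JV) YE)) //.
  rewrite (le_trans (norm2_le_norm _)) // ler_wpM2l ?sqrtr_ge0 //.
  rewrite (le_trans (mulmx_norm_le _ _)) // ler_wpM2l // ler_wpM2r //.
  apply: (res (z (theta + t *: h))) => //; apply: zr.
  rewrite opprD addrA subrr add0r normrN normrZ.
  have /andP[t0 t1] : 0 <= t <= 1 by [].
  by rewrite ger0_norm // (le_lt_trans _ hr) // ler_piMl.
Qed.
End ImplicitDerivative.

(** * Forward and reverse modes *)

Section Propagation.
Set Implicit Arguments.
Unset Strict Implicit.
Variables (R : realType) (p m : nat).
Variables (F : 'cV[R]_(p + m) -> 'cV[R]_p).
Variables (JF : 'cV[R]_(p + m) -> set 'M[R]_(p, p + m)).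
Hypothesis JFc : conservative_jacobian F JF.
Variable rho : R.
Hypotheses (rho0 : 0 <= rho) (rho1 : rho < 1).
Hypothesis JF_rho : forall x theta (A : 'M[R]_p) (B : 'M[R]_(p, m)),
  JF (col_mx x theta) (row_mx A B) -> op_norm A <= rho.
Variable xbar : 'cV[R]_m -> 'cV[R]_p.
Hypothesis xbarE : forall theta, F (col_mx (xbar theta) theta) = xbar theta.
Variables (x0 : 'cV[R]_m -> 'cV[R]_p) (Jx0 : 'cV[R]_m -> set 'M[R]_(p, m)).
Hypothesis Jx0c : conservative_jacobian x0 Jx0.
Variable theta : 'cV[R]_m.
Variable D : 'M[R]_(p, m).
Hypothesis DE : forall V, JF (col_mx (xbar theta) theta) V ->
  D = lsubmx V *m D + rsubmx V.

Let zk k := col_mx (iterate F x0 theta k) theta.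

(* Both modes compute products with the matrices P_k of the recursion
   P_0 = J, P_(i+1) = A_i P_i + B_i, one for each choice of selections. *)
Fixpoint propagated (k : nat) (P : 'M[R]_(p, m)) : Prop :=
  if k is i.+1 then
    exists V P', [/\ JF (zk i) V, propagated i P' & P = lsubmx V *m P' + rsubmx V]
  else Jx0 theta P.

Lemma forward_mode_propagated k dtheta out :
  forward_mode F JF x0 Jx0 theta k dtheta out ->
  exists2 P, propagated k P & out = P *m dtheta.
Proof.
elim: k out => [|k IH] out /=; first by case=> J; exists J.
move=> [dx [A [B [/IH [P' kP' ->] JAB ->]]]].
exists (A *m P' + B); last by rewrite mulmxDl mulmxA.
by exists (row_mx A B), P'; rewrite row_mxKl row_mxKr.
Qed.

(** The loop meets the last Jacobian first, and this is the outermost factor of the recursion: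
    transposing A P' + B yields the accumulator update B^T w and the vector A^T w passed on to
    P'. *)
Lemma reverse_loop_propagated k tbar w out :
  reverse_loop F JF x0 Jx0 theta k tbar w out ->
  exists2 P, propagated k P & out = tbar + P^T *m w.
Proof.
elim: k tbar w => [|k IH] tbar w /=; first by case=> J; exists J.
move=> [A [B [JAB /IH [P' kP' ->]]]].
exists (A *m P' + B).
  by exists (row_mx A B), P'; rewrite row_mxKl row_mxKr.
by rewrite linearD /= trmx_mul mulmxDl -mulmxA addrA addrAC -addrA.
Qed.

Lemma iterate_cvg (eps : R) : 0 < eps ->
  exists K, forall k, (K <= k)%N -> `|col_mx (xbar theta) theta - zk k| < eps.
Proof.
move=> eps0; pose c := norm2 (x0 theta - xbar theta).
have le_geo k : norm2 (iterate F x0 theta k - xbar theta) <= rho ^+ k * c.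
  elim: k => [|k IH]; first by rewrite expr0 mul1r.
  rewrite /= -[in leLHS]xbarE exprS -mulrA.
  apply: (le_trans (F_contraction_le JFc rho0 JF_rho _ _ _)).
  by rewrite ler_wpM2l.
have : (fun k => rho ^+ k * c) @ \oo --> (0 : R).
  rewrite -(mul0r c); apply: cvgMl; apply: cvg_expr; by rewrite ger0_norm.
move=> /cvgrPdist_lt /(_ _ eps0) [K _ HK]; exists K => k /HK /=.
rewrite sub0r normrN ger0_norm ?mulr_ge0 ?exprn_ge0 ?norm2_ge0 // => lt_eps.
rewrite /zk opp_col_mx add_col_mx subrr (le_lt_trans _ lt_eps) //.
rewrite (le_trans _ (le_geo k)) // (le_trans _ (norm2_ge_norm _)) //.
by rewrite col_mx_norm_le ?normr0 // distrC.
Qed.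

(** Left multiplication by A contracts each Euclidean column norm by [rho], hence also their sum;
    the max norm would introduce a dimensional factor. *)
Definition colnorm (M : 'M[R]_(p, m)) : R := \sum_(j < m) norm2 (col j M).

Lemma colnorm_ge0 M : 0 <= colnorm M.
Proof. by apply: sumr_ge0 => j _; exact: norm2_ge0. Qed.

Lemma colnorm_ge M : `|M| <= colnorm M.
Proof.
apply: mx_norm_leP => [|i j]; first exact: colnorm_ge0.
have -> : M i j = col j M i 0 by rewrite mxE.
rewrite (le_trans (mx_entry_le _ _ _)) // (le_trans (norm2_ge_norm _)) //.
by rewrite /colnorm (bigD1 j) //= lerDl sumr_ge0 // => k _; exact: norm2_ge0.
Qed.

Lemma colnorm_le M : colnorm M <= m%:R * (Num.sqrt p%:R * `|M|).
Proof.
rewrite mulr_natl -[X in _ <= _ *+ X](card_ord m) -sumr_const.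
apply: ler_sum => j _; rewrite (le_trans (norm2_le_norm _)) //.
rewrite ler_wpM2l ?sqrtr_ge0 //; apply: mx_norm_leP => // i l.
by rewrite mxE mx_entry_le.
Qed.

Lemma colnorm_step u V P c : JF u V -> `|lsubmx V *m D + rsubmx V - D| <= c ->
  colnorm (lsubmx V *m P + rsubmx V - D) <=
  rho * colnorm (P - D) + m%:R * (Num.sqrt p%:R * c).
Proof.
move=> JV resc.
have -> : lsubmx V *m P + rsubmx V - D =
    lsubmx V *m (P - D) + (lsubmx V *m D + rsubmx V - D).
  by rewrite mulmxBr [RHS]addrA [in RHS]addrA subrK.
set E := _ + _ - D in resc *.
apply: (@le_trans _ _ (rho * colnorm (P - D) + colnorm E)); last first.
  rewrite lerD2l (le_trans (colnorm_le _)) // ler_wpM2l // ler_wpM2l ?sqrtr_ge0 //.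
rewrite /colnorm mulr_sumr -big_split /=; apply: ler_sum => j _.
rewrite linearD /= (le_trans (norm2D _ _)) // lerD2r.
by rewrite !colE -mulmxA (JF_contract JF_rho _ JV).
Qed.

(** The first iterates may be far from the fixed point, where the residual of [D] is not small; a
    bound uniform in the selections is enough to start the geometric decay. *)
Lemma propagated_bounded k : exists M, forall P, propagated k P -> colnorm (P - D) <= M.
Proof.
elim: k => [|k [M IH]].
  have [M HM] := cj_locally_bounded Jx0c theta.
  exists (m%:R * (Num.sqrt p%:R * (M + `|D|))) => P /= JP.
  rewrite (le_trans (colnorm_le _)) // ler_wpM2l // ler_wpM2l ?sqrtr_ge0 //.
  by rewrite (le_trans (ler_normB _ _)) // lerD2r; apply: (nbhs_singleton HM).
have [N HN] := cj_locally_bounded JFc (zk k).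
exists (rho * M + m%:R * (Num.sqrt p%:R * (p%:R * (N * `|D|) + N + `|D|))).
move=> P [V [P' [JV kP' ->]]].
have VN : `|V| <= N by exact: (nbhs_singleton HN).
apply: (le_trans (colnorm_step (c := p%:R * (N * `|D|) + N + `|D|) P' JV _)).
  rewrite (le_trans (ler_normB _ _)) // lerD2r (le_trans (ler_normD _ _)) // lerD //.
    rewrite (le_trans (mulmx_norm_le _ _)) // ler_wpM2l // ler_wpM2r //.
    by rewrite (le_trans _ VN) // -[X in _ <= `|X|]hsubmxK row_mx_norm_l.
  by rewrite (le_trans _ VN) // -[X in _ <= `|X|]hsubmxK row_mx_norm_r.
by rewrite lerD2r ler_wpM2l // IH.
Qed.

(** Once the iterates are close to the fixed point, the error obeys x -> rho x + (1 - rho) eps / 2,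
    whose fixed point is eps / 2, whatever the selections. *)
Lemma propagated_cvg (eps : R) : 0 < eps ->
  \forall k \near \oo, forall P, propagated k P -> `|P - D| <= eps.
Proof.
move=> eps0.
have rho1' : 0 < 1 - rho by rewrite subr_gt0.
pose C : R := m%:R * Num.sqrt p%:R + 1.
have C0 : 0 < C by rewrite ltr_wpDl // mulr_ge0 // sqrtr_ge0.
(* The factor [C] compensates the constant m sqrt(p) of [colnorm_step]. *)
pose c : R := (1 - rho) * (eps / 2) / C.
have c0 : 0 < c by rewrite !(divr_gt0, mulr_gt0).
have [delta delta0 res] := residual_near JFc DE c0.
have [K HK] := iterate_cvg delta0.
have [M HM] := propagated_bounded K.
have le_geo n P : propagated (K + n) P ->
    colnorm (P - D) <= rho ^+ n * `|M| + eps / 2.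
  elim: n P => [|n IH] P.
    rewrite addn0 expr0 mul1r => /HM /le_trans; apply.
    by rewrite ler_wpDr ?ler_norm // divr_ge0 // ltW.
  rewrite addnS => -[V [P' [JV kP' ->]]].
  apply: (le_trans (colnorm_step (c := c) P' JV _)).
    by apply: (res (zk (K + n))) => //; apply: HK; exact: leq_addr.
  apply: (@le_trans _ _ (rho * (rho ^+ n * `|M| + eps / 2) + (1 - rho) * (eps / 2))).
    rewrite lerD //; first by rewrite ler_wpM2l // IH.
    rewrite mulrA /c mulrCA ger_pMr ?mulr_gt0 ?divr_gt0 // ler_pdivrMr // mul1r.
    by rewrite lerDl.
  rewrite exprS le_eqVlt; apply/orP; left; apply/eqP; ring.
have : (fun n => rho ^+ n * `|M|) @ \oo --> (0 : R).
  rewrite -(mul0r `|M|); apply: cvgMl; apply: cvg_expr; by rewrite ger0_norm.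
have eps20 : 0 < eps / 2 by rewrite divr_gt0.
move=> /cvgrPdist_lt /(_ _ eps20) [N _ HN]; exists (K + N)%N => // k /= kKN P kP.
rewrite (le_trans (colnorm_ge _)) //.
have Kk : (K <= k)%N by rewrite (leq_trans _ kKN) // leq_addr.
have := le_geo (k - K)%N P; rewrite subnKC // => /(_ kP) h.
have := HN (k - K)%N; rewrite /= leq_subRL // => /(_ kKN).
rewrite sub0r normrN ger0_norm ?mulr_ge0 ?exprn_ge0 // => h2; lra.
Qed.

Lemma forward_mode_cvg dtheta (dx : nat -> 'cV[R]_p) :
  (forall k, forward_mode F JF x0 Jx0 theta k dtheta (dx k)) ->
  dx @ \oo --> D *m dtheta.
Proof.
move=> fdx; apply/cvgrPdist_le => eps eps0.
pose C : R := m%:R * `|dtheta| + 1.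
have C0 : 0 < C by rewrite ltr_wpDl // mulr_ge0.
have eC : 0 < eps / C by rewrite divr_gt0.
apply: filterS (propagated_cvg eC) => k h.
have [P kP ->] := forward_mode_propagated (fdx k).
rewrite distrC -mulmxBl (le_trans (mulmx_norm_le _ _)) // mulrCA.
apply: (@le_trans _ _ (eps / C * C)); last by rewrite divfK // gt_eqF.
by rewrite ler_pM ?mulr_ge0 ?h ?lerDl.
Qed.

Lemma reverse_mode_cvg (w : nat -> 'cV[R]_p) (wbar : 'cV[R]_p)
    (tbar : nat -> 'cV[R]_m) :
  w @ \oo --> wbar ->
  (forall k, reverse_mode F JF x0 Jx0 theta k (w k) (tbar k)) ->
  (fun k => (tbar k)^T) @ \oo --> wbar^T *m D.
Proof.
move=> wcv rt; apply/cvgrPdist_le => eps eps0.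
pose C : R := p%:R * (`|wbar| + 1) + 1.
have C0 : 0 < C by rewrite ltr_wpDl // mulr_ge0 // addr_ge0.
have eC : 0 < eps / 2 / C by rewrite !divr_gt0.
pose C' : R := p%:R * `|D| + 1.
have C'0 : 0 < C' by rewrite ltr_wpDl // mulr_ge0.
(* The cap 1 bounds [w k] by [|wbar| + 1], as is needed in the term with [P - D]. *)
have eC' : 0 < Num.min 1 (eps / 2 / C') by rewrite lt_min ltr01 !divr_gt0.
have /cvgrPdist_lt /(_ _ eC') wnear := wcv.
near=> k.
have [P kP ->] := reverse_loop_propagated (rt k).
have Pk : `|P - D| <= eps / 2 / C.
  by move: P kP; near: k; exact: propagated_cvg.
have : `|wbar - w k| < Num.min 1 (eps / 2 / C') by near: k.
rewrite lt_min => /andP[w1 wk].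
rewrite add0r trmx_mul trmxK.
have -> : wbar^T *m D - (w k)^T *m P = (wbar - w k)^T *m D - (w k)^T *m (P - D).
  by rewrite linearB /= mulmxBl mulmxBr opprB addrA subrK.
rewrite (le_trans (ler_normB _ _)) // [leRHS]splitr lerD //.
  rewrite (le_trans (mulmx_norm_le _ _)) // trmx_norm mulrCA.
  apply: (@le_trans _ _ (eps / 2 / C' * C')); last by rewrite divfK // gt_eqF.
  by rewrite ler_pM ?mulr_ge0 ?lerDl ?(ltW wk).
rewrite (le_trans (mulmx_norm_le _ _)) // trmx_norm mulrA mulrC.
apply: (@le_trans _ _ (eps / 2 / C * C)); last by rewrite divfK // gt_eqF.
rewrite ler_pM ?mulr_ge0 //.
rewrite (@le_trans _ _ (p%:R * (`|wbar| + 1))) ?lerDl // ler_wpM2l //.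
by have := ler_normB wbar (wbar - w k); rewrite subKr; lra.
Unshelve. all: by end_near. Qed.

End Propagation.

Theorem proposition1 (R : realType) (p m : nat)
    (F : 'cV[R]_(p + m) -> 'cV[R]_p)
    (JF : 'cV[R]_(p + m) -> set 'M[R]_(p, p + m))
    (F_lipschitz : locally_lipschitz F)
    (F_path_differentiable : path_differentiable F)
    (JF_conservative : conservative_jacobian F JF)
    (F_contraction : exists rho : R, 0 <= rho < 1 /\
      forall (x : 'cV[R]_p) (theta : 'cV[R]_m)
             (A : 'M[R]_p) (B : 'M[R]_(p, m)),
        JF (col_mx x theta) (row_mx A B) -> op_norm A <= rho)
    (x0 : 'cV[R]_m -> 'cV[R]_p)
    (Jx0 : 'cV[R]_m -> set 'M[R]_(p, m))
    (x0_lipschitz : lipschitz x0)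
    (x0_path_differentiable : path_differentiable x0)
    (Jx0_conservative : conservative_jacobian x0 Jx0)
    (dtheta : 'cV[R]_m)
    (xbar : 'cV[R]_m -> 'cV[R]_p)
    (xbar_fixpoint : forall theta : 'cV[R]_m,
      unique (fun x => F (col_mx x theta) = x) (xbar theta)) :
  for_almost_all (fun theta : 'cV[R]_m =>
    differentiable xbar theta /\
    forall dx : nat -> 'cV[R]_p,
      (forall k, forward_mode F JF x0 Jx0 theta k dtheta (dx k)) ->
      dx @ \oo --> jac xbar theta *m dtheta)
  /\
  (forall (w : nat -> 'cV[R]_m -> 'cV[R]_p) (wbar : 'cV[R]_m -> 'cV[R]_p),
    (forall theta : 'cV[R]_m, (fun k => w k theta) @ \oo --> wbar theta) ->
    for_almost_all (fun theta : 'cV[R]_m =>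
      differentiable xbar theta /\
      forall tbar : nat -> 'cV[R]_m,
        (forall k, reverse_mode F JF x0 Jx0 theta k (w k theta) (tbar k)) ->
        (fun k => (tbar k)^T) @ \oo --> (wbar theta)^T *m jac xbar theta)).
Proof.
have [rho [/andP[rho0 rho1] JF_rho]] := F_contraction.
have xbarE theta : F (col_mx (xbar theta) theta) = xbar theta.
  by have [] := xbar_fixpoint theta.
(* A single null set, determined by [JF] and [xbar], serves both modes, every [dtheta] and every
   sequence [w]. *)
have ae := almost_all_unambiguous JF_conservative rho0 rho1 JF_rho xbarE.
have limits theta : unambiguous JF xbar theta -> differentiable xbar theta /\
    forall V, JF (col_mx (xbar theta) theta) V ->
      jac xbar theta = lsubmx V *m jac xbar theta + rsubmx V.
  move=> unamb.
  have [D DE] := unambiguous_solution JF_conservative rho1 JF_rho unamb.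
  by have [? ->] := xbar_differentiable JF_conservative rho0 rho1 JF_rho xbarE DE.
split => [|w wbar wcv]; apply: (lebesgue_null_sub _ ae) => theta /=;
  apply: contra_not => /limits [dxbar DE]; split => //.
  move=> dx; exact: (forward_mode_cvg JF_conservative rho0 rho1 JF_rho xbarE
    Jx0_conservative DE).
move=> tbar; exact: (reverse_mode_cvg JF_conservative rho0 rho1 JF_rho xbarE
  Jx0_conservative DE (wcv theta)).
Qed.
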